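(* Fix $\varepsilon>0$ and let the online two-point direct search described in the context be run with probing ratios $$\delta_t=\frac{1}{\sqrt{t+1}}.$$ Let $T\ge2$ be an even integer, let $\mathcal{E}_T=\frac{2D_T+2B_T}{T}$, and suppose that $$\mathcal{E}_T\le\frac{\varepsilon}{2\sqrt{2\pi p}\,(\sqrt2+1)\sqrt{T}} .$$ Then, if $T$ satisfies $$T\ge\max\Big\{\frac{2\pi p(\sqrt2+1)^2}{\varepsilon^2}\big(4(\Phi_0(u_0)-\Phi_{\mathrm{low}})+L\big)^2,\ \frac{8\pi p(\sqrt2+1)^2L^2}{\varepsilon^2}\log^2\Big(\frac{2(\sqrt2+1)\sqrt{2\pi p}\,L}{\varepsilon}\Big)\Big\},$$ the iterates satisfy $$\min_{t\in[T]_2}\mathbb{E}\big[\|\nabla\Phi_t(u_t)\|\big]\le\varepsilon .$$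
   Context: $\mathbb{N}=\{0,1,2,\dots\}$, $p\ge1$ is an integer, $\|\cdot\|$ is the Euclidean norm, and $\log$ is the natural logarithm. For even $T\ge2$, $[T]_2=\{0,2,\dots,T-2\}$. Objectives: for each $t\in\mathbb{N}$, $\Phi_t:\mathbb{R}^p\to\mathbb{R}$ is differentiable with $L$-Lipschitz continuous gradient (same constant $L>0$ for all $t$), and $\Phi_t(u)\ge\Phi_{\mathrm{low}}$ for all $u$ and $t$, with $\Phi_{\mathrm{low}}\in\mathbb{R}$. Inexact oracle: for each $t$, $\tilde\Phi_t:\mathbb{R}^p\to\mathbb{R}$ is a (deterministic) continuous function. Temporal drift: $d_t=\sup_{u\in\mathbb{R}^p}|\Phi_{t+1}(u)-\Phi_t(u)|$, assumed finite for all $t$, and $D_T=\sum_{t=0}^{T-1}d_t$. Oracle error: $b_t=\sup_{u\in\mathbb{R}^p}|\tilde\Phi_t(u)-\Phi_t(u)|$, assumed finite for all $t$, and $B_T=\sum_{t=0}^{T-1}b_t$. Online two-point direct search: given a deterministic $u_0\in\mathbb{R}^p$ and a deterministic sequence of positive probing ratios $\delta_t$, for $t=0,2,4,\dots$: draw $v_t\sim\mathcal{N}(0,\frac1pI_p)$ independently of all previous draws, set $u_{t+1}=u_t+\delta_tv_t$, and set $u_{t+2}=u_{t+1}$ if $\tilde\Phi_{t+1}(u_{t+1})\le\tilde\Phi_t(u_t)$, and $u_{t+2}=u_t$ otherwise. $\mathbb{E}$ is expectation over the random directions. *)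

(* Defs.v *)
From HB Require Import structures.
From mathcomp Require Import all_boot all_order all_algebra finmap.
From mathcomp Require Import all_classical all_reals all_analysis.

Set Implicit Arguments.
Unset Strict Implicit.
Unset Printing Implicit Defensive.

Import Order.TTheory GRing.Theory Num.Theory.
Import numFieldNormedType.Exports.

Local Open Scope classical_set_scope.
Local Open Scope ring_scope.

(* The library norm on 'rV[R]_p is the sup norm. *)
Definition enorm (R : realType) (p : nat) (x : 'rV[R]_p) : R :=
  Num.sqrt (\sum_(i < p) x ord0 i ^+ 2).

Definition grad (R : realType) (p : nat) (f : 'rV[R]_p -> R) (x : 'rV[R]_p) :
    'rV[R]_p :=
  \row_(i < p) 'D_(delta_mx ord0 i) f x.

Definition lipschitz_grad (R : realType) (p : nat) (L : R)
    (f : 'rV[R]_p -> R) : Prop :=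
  (forall x, differentiable f x) /\
  (forall x y, enorm (grad f x - grad f y) <= L * enorm (x - y)).

Definition gaps (R : realType) (p : nat) (f g : 'rV[R]_p -> R) : set R :=
  range (fun u => `|f u - g u|).

(* [sup] is the real supremum: it is meaningful only on bounded sets, whence
   the finiteness assumptions [has_ubound (gaps _ _)] in the theorem. *)
Definition drift (R : realType) (p : nat) (Phi : nat -> 'rV[R]_p -> R)
    (t : nat) : R :=
  sup (gaps (Phi t.+1) (Phi t)).

Definition oracle_error (R : realType) (p : nat)
    (Phit Phi : nat -> 'rV[R]_p -> R) (t : nat) : R :=
  sup (gaps (Phit t) (Phi t)).

(* R^p with its Borel sigma-algebra. *)
Definition borel_rV (R : realType) (p : nat) :=
  g_sigma_algebraType [set U : set 'rV[R]_p | open U].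

(* The law of V is N(0, s2 I_p), i.e. the p-fold product of the univariate
   N(0, s2); the second parameter of [normal_prob] is a standard deviation. *)
Definition isotropic_normal (d : measure_display) (Omega : measurableType d)
    (R : realType) (P : probability Omega R) (p : nat) (s2 : R)
    (V : {RV P >-> borel_rV R p}) : Prop :=
  forall A : 'I_p -> set R, (forall i, measurable (A i)) ->
    distribution P V [set x : 'rV[R]_p | forall i, A i (x ord0 i)] =
    (\prod_(i < p) normal_prob 0 (Num.sqrt s2) (A i))%E.

Definition mutually_independent (d d' : measure_display)
    (Omega : measurableType d) (T : measurableType d') (R : realType)
    (P : probability Omega R) (I : choiceType) (D : set I)
    (X : I -> {RV P >-> T}) : Prop :=
  forall (J : {fset I}) (A : I -> set T),
    [set` J] `<=` D -> (forall i, measurable (A i)) ->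
    P (\bigcap_(i in [set` J]) (X i @^-1` A i)) =
    (\prod_(i <- J) P (X i @^-1` A i))%E.

(* The sequence u is the trajectory of online two-point direct search with
   oracle Phit and probing ratios delta, along the directions v t, t even. *)
Definition online_direct_search (R : realType) (p : nat)
    (Phit : nat -> 'rV[R]_p -> R) (delta : nat -> R) (u0 : 'rV[R]_p)
    (v u : nat -> 'rV[R]_p) : Prop :=
  u 0%N = u0 /\
  forall t : nat, ~~ odd t ->
    u t.+1 = u t + delta t *: v t /\
    u t.+2 = if Phit t.+1 (u t.+1) <= Phit t (u t) then u t.+1 else u t.

(* Main.v *)
Require Import Defs.
From HB Require Import structures.
From mathcomp Require Import all_boot all_order all_algebra finmap.
From mathcomp Require Import all_classical all_reals all_analysis.
From mathcomp Require Import measurable_realfun.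
From mathcomp Require Import ring lra zify.

Set Implicit Arguments.
Unset Strict Implicit.
Unset Printing Implicit Defensive.

Import Order.TTheory GRing.Theory Num.Theory.
Import numFieldNormedType.Exports.

Local Open Scope classical_set_scope.
Local Open Scope ring_scope.

(** At an even time t let U = u_t, let V be the fresh Gaussian direction and
    g the gradient of Phi_t at U. Up to drift and oracle errors the search
    moves to the better of U and U + delta V, so the objective never goes up,
    and when <g, V> is negative smoothness makes it go down by at least
    - delta <g, V> - L delta^2 |V|^2 / 2 ([search_descent]).

    U is a function of the earlier directions, hence independent of V, and
    one may average over V first, with U frozen ([indep_ge0_integral]). Then
    <g, V> is centered normal with standard deviation |g| / sqrt p, so the
    expected gain is exactly delta |g| / sqrt (2 pi p)
    ([dot_neg_part_expectation]). The cost |V|^2 is paid only on the half-space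
    <g, V> < 0, which carries at most half of E |V|^2 = 1 because V and - V
    have the same law ([enorm_sqr_halfspace_expectation]). This factor one half
    is what the constants in the lower bound on T rely on. Altogether
    ([expected_descent]), up to the errors,
      E Phi_(t+2)(u_(t+2)) + delta_t E |g| / sqrt (2 pi p)
        <= E Phi_t(u_t) + L delta_t^2 / 4.
    Every term is nonnegative once Phi_low is subtracted, so these inequalities
    can be telescoped in the extended reals with no integrability argument:
      sum delta_t E |g_t| <= sqrt (2 pi p) *
        (Phi_0(u_0) - Phi_low + (L / 4) sum delta_t^2 + 2 D_T + 2 B_T).
    If every E |g_t| exceeded eps, the left-hand side would exceed
    eps sum delta_t. Over the even t < T the step sizes satisfy
    sum delta_t >= sqrt T / (sqrt 2 + 1) and sum delta_t^2 <= 1 + (ln T) / 2,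
    and the lower bounds on T make that impossible ([step_size_tradeoff]).

    Two independence statements are needed: u_t from v_t, and the partial sums
    of <g, V> from the next coordinate of V (which, with the convolution of
    centered normal laws, yields the law of <g, V>). Both are instances of
    [indep_markov_chain]: if Z_(k+1) is a function of Z_k and X_k, where the
    X_k are independent, then Z_k and X_k are independent. *)

(** * Borel sets of R^p *)

Lemma measurable_preimage d d' (T : measurableType d) (T' : measurableType d')
    (f : T -> T') (A : set T') :
  measurable_fun setT f -> measurable A -> measurable (f @^-1` A).
Proof. by move=> mf mA; rewrite -[X in measurable X]setTI; exact: mf. Qed.

Lemma continuous_measurable_rV (R : realType) p (f : borel_rV R p -> R) :
  continuous (f : 'rV[R]_p -> R) -> measurable_fun setT f.
Proof.
move=> /continuousP fc.
apply: (measurability _ (RGenOpens.measurableE R)).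
move=> _ [_ [a [b ->]] <-]; rewrite setTI.
by apply: sub_sigma_algebra; apply: fc; exact: interval_open.
Qed.

Lemma measurable_coord_rV (R : realType) p (i : 'I_p) :
  measurable_fun setT (fun x : borel_rV R p => x ord0 i).
Proof. by apply: continuous_measurable_rV; exact: coord_continuous. Qed.

Definition box (R : realType) p (A : 'I_p -> set R) : set 'rV[R]_p :=
  [set x | forall i, A i (x ord0 i)].

Definition rat_cube (R : realType) p (k : 'rV[rat]_p * nat) : set 'rV[R]_p :=
  box (fun i => ball (ratr (k.1 ord0 i) : R) k.2.+1%:R^-1).

(** Balls of the sup norm are cubes, so second countability of R^p can be
    stated with countably many boxes: this is what links the Borel sets of R^p
    to the coordinate maps. *)
Lemma open_bigcup_rat_cube (R : realType) p (U : set 'rV[R]_p) : open U ->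
  U = \bigcup_k if `[< rat_cube k `<=` U >] then rat_cube k else set0.
Proof.
move=> oU; apply/seteqP; split => [x Ux|x [k _]]; last first.
  by case: asboolP => // kU; exact: kU.
have /nbhs_ballP[e /= e0 xeU] := open_nbhs_nbhs (conj oU Ux).
have [n ne] : exists n, (n.+1%:R^-1 : R) < e / 2.
  exists (Num.bound (e / 2)^-1); rewrite invf_plt ?posrE ?divr_gt0 ?ltr0n//.
  have e20 : 0 <= (e / 2)^-1 by rewrite invr_ge0 divr_ge0 ?ltW.
  by rewrite (lt_le_trans (archi_boundP e20))// ler_nat.
have n0 : 0 < (n.+1%:R^-1 : R) by rewrite invr_gt0 ltr0n.
have /choice[q xq] i : exists q : rat, ball (ratr q : R) n.+1%:R^-1 (x ord0 i).
  have [|q] := @rat_in_itvoo _ (x ord0 i - n.+1%:R^-1) (x ord0 i + n.+1%:R^-1).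
    by rewrite ltrBlDr -addrA ltrDl addr_gt0.
  rewrite in_itv/= => /andP[? ?]; exists q.
  by rewrite /ball/= ltr_distl; apply/andP.
have cubeE y : rat_cube (\row_i q i, n) y <->
    forall i, ball (ratr (q i) : R) n.+1%:R^-1 (y ord0 i).
  by split=> + i => /(_ i); rewrite /= mxE.
exists (\row_i q i, n) => //; case: asboolP => [_|]; first exact/cubeE.
case=> y /cubeE yq; apply: xeU; split => // i j; rewrite [i]ord1.
apply: (@ball_splitr _ _ (ratr (q j) : R)).
  exact: le_ball (ltW ne) _ (xq j).
exact: le_ball (ltW ne) _ (yq j).
Qed.

Lemma preimage_box (R : realType) p T (f : T -> 'rV[R]_p) (A : 'I_p -> set R) :
  f @^-1` box A = \bigcap_i (fun x => f x ord0 i) @^-1` A i.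
Proof. by apply/seteqP; split => [x fA i _|x fA i]; exact: fA. Qed.

(** The Borel sigma-algebra of R^p is the product one. *)
Lemma measurable_fun_rV d (T : measurableType d) (R : realType) p
    (f : T -> borel_rV R p) :
  (forall i, measurable_fun setT (fun x => (f x : 'rV[R]_p) ord0 i)) ->
  measurable_fun setT f.
Proof.
move=> mf; apply: (@measurability _ _ T (borel_rV R p) setT f
  [set U : set 'rV[R]_p | open U]) => //.
move=> _ [U /open_bigcup_rat_cube -> <-]; rewrite setTI preimage_bigcup.
apply: countable_bigcupT_measurable => [|k]; first exact: countableP.
case: asboolP => _; last by rewrite preimage_set0.
rewrite preimage_box; apply: fin_bigcap_measurable => // i _.
by apply: measurable_preimage; [exact: mf|exact: measurable_ball].
Qed.

Lemma measurable_box (R : realType) p (A : 'I_p -> set R) :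
  (forall i, measurable (A i)) -> measurable (box A : set (borel_rV R p)).
Proof.
move=> mA; rewrite -[box A]preimage_id preimage_box.
apply: fin_bigcap_measurable => // i _.
by apply: measurable_preimage => //; exact: measurable_coord_rV.
Qed.

(** Boxes are stable under intersection and generate the Borel sets, so a law
    given on boxes, such as that of an isotropic normal vector, is known
    everywhere. *)
Lemma box_measure_unique (R : realType) p
    (m1 m2 : {finite_measure set borel_rV R p -> \bar R}) :
  (forall A : 'I_p -> set R, (forall i, measurable (A i)) ->
    m1 (box A) = m2 (box A)) ->
  forall B, measurable B -> m1 B = m2 B.
Proof.
move=> m12.
pose G :=
  [set box A | A in [set A : 'I_p -> set R | forall i, measurable (A i)]].
apply: (@measure_unique _ R (borel_rV R p) G (fun=> setT)) => [| | | | |k].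
- apply/seteqP; split => [B|B]; apply: smallest_sub.
  + exact: smallest_sigma_algebra.
  + move=> U /open_bigcup_rat_cube ->.
    apply: (@countable_bigcupT_measurable _ (g_sigma_algebraType G)) => [|k].
      exact: countableP.
    case: asboolP => _; last exact: measurable0.
    apply: sub_sigma_algebra.
    exists (fun i => ball (ratr (k.1 ord0 i) : R) k.2.+1%:R^-1) => // i.
    exact: measurable_ball.
  + exact: sigma_algebra_measurable.
  + by move=> _ [A mA <-]; exact: measurable_box.
- move=> _ _ [A mA <-] [B mB <-]; exists (fun i => A i `&` B i).
    by move=> i; apply: measurableI; [exact: mA|exact: mB].
  apply/seteqP; split => x /=.
    by move=> AB; split => i; have [] := AB i.
  by move=> [HA HB] i; split; [exact: HA|exact: HB].
- by move=> _; exists (fun=> setT) => //=; apply/seteqP; split.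
- by rewrite bigcup_const.
- by move=> _ [A mA <-]; exact: m12.
- by rewrite -ge0_fin_numE// fin_num_measure.
Qed.

(** * Euclidean geometry and smoothness *)

Definition dot (R : realType) p (x y : 'rV[R]_p) : R :=
  \sum_(i < p) x ord0 i * y ord0 i.

Section euclidean.
Context {R : realType} {p : nat}.
Implicit Types x y z : 'rV[R]_p.

Lemma enorm_ge0 x : 0 <= enorm x. Proof. exact: sqrtr_ge0. Qed.

Lemma sqr_enorm_sum x : enorm x ^+ 2 = \sum_i x ord0 i ^+ 2.
Proof. by rewrite sqr_sqrtr// sumr_ge0// => i _; exact: sqr_ge0. Qed.

Lemma sqr_enorm x : enorm x ^+ 2 = dot x x.
Proof. by rewrite sqr_enorm_sum; apply: eq_bigr => i _; rewrite expr2. Qed.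

Lemma dotBl x y z : dot (x - y) z = dot x z - dot y z.
Proof. by rewrite /dot -sumrB; apply: eq_bigr => i _; rewrite !mxE mulrBl. Qed.

Lemma dotZr a x y : dot x (a *: y) = a * dot x y.
Proof.
by rewrite /dot mulr_sumr; apply: eq_bigr => i _; rewrite mxE mulrCA.
Qed.

Lemma enormZ a x : enorm (a *: x) = `|a| * enorm x.
Proof.
rewrite /enorm -(sqrtr_sqr a) -sqrtrM ?sqr_ge0//; congr Num.sqrt.
by rewrite mulr_sumr; apply: eq_bigr => i _; rewrite mxE exprMn.
Qed.

Lemma coord_le_enorm x i : `|x ord0 i| <= enorm x.
Proof.
rewrite -sqrtr_sqr ler_wsqrtr// (bigD1 i)//= lerDl sumr_ge0// => j _.
exact: sqr_ge0.
Qed.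

Lemma dot_le_enorm x y : dot x y <= enorm x * enorm y.
Proof.
have [x0|x0] := eqVneq (enorm x) 0.
  rewrite x0 mul0r /dot big1// => i _.
  have : `|x ord0 i| <= 0 by rewrite -x0 coord_le_enorm.
  by rewrite normr_le0 => /eqP ->; rewrite mul0r.
have [y0|y0] := eqVneq (enorm y) 0.
  rewrite y0 mulr0 /dot big1// => i _.
  have : `|y ord0 i| <= 0 by rewrite -y0 coord_le_enorm.
  by rewrite normr_le0 => /eqP ->; rewrite mulr0.
set a := enorm x in x0 *; set b := enorm y in y0 *.
have a0 : 0 < a by rewrite lt_neqAle eq_sym x0 enorm_ge0.
have b0 : 0 < b by rewrite lt_neqAle eq_sym y0 enorm_ge0.
(* the sum of squares is |b x - a y|^2 = 2 a b (a b - <x, y>) *)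
have : 0 <= \sum_i (b * x ord0 i - a * y ord0 i) ^+ 2.
  by rewrite sumr_ge0// => i _; exact: sqr_ge0.
have -> : \sum_i (b * x ord0 i - a * y ord0 i) ^+ 2 =
    b ^+ 2 * dot x x - 2 * a * b * dot x y + a ^+ 2 * dot y y.
  rewrite /dot !mulr_sumr -sumrB -big_split/=; apply: eq_bigr => i _; ring.
rewrite -!sqr_enorm -/a -/b.
have -> : b ^+ 2 * a ^+ 2 - 2 * a * b * dot x y + a ^+ 2 * b ^+ 2 =
  (2 * a * b) * (a * b - dot x y) by ring.
by rewrite pmulr_rge0 ?mulr_gt0// subr_ge0.
Qed.

Lemma continuous_enorm : continuous (@enorm R p).
Proof.
have sum_cont : continuous (fun x : 'rV[R]_p => \sum_i x ord0 i ^+ 2).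
  apply: (@continuous_big R 'I_p +%R 0 predT) => [|i _ x].
    exact: add_continuous.
  apply: (cvg_comp (fun x : 'rV[R]_p => x ord0 i) (fun r => r ^+ 2)).
    exact: coord_continuous.
  exact: exprn_continuous.
move=> x; apply: (cvg_comp (fun x : 'rV[R]_p => \sum_i x ord0 i ^+ 2) Num.sqrt).
  exact: sum_cont.
exact: sqrt_continuous.
Qed.

Lemma measurable_enorm :
  measurable_fun setT (fun x : borel_rV R p => enorm (x : 'rV[R]_p)).
Proof. exact: continuous_measurable_rV continuous_enorm. Qed.

End euclidean.

Section smooth.
Context {R : realType} {p : nat}.
Variables (L : R) (f : 'rV[R]_p -> R).
Hypotheses (L_gt0 : 0 < L) (f_smooth : lipschitz_grad L f).

Lemma derive_dot_grad (x h : 'rV[R]_p) : 'D_h f x = dot (grad f x) h.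
Proof.
have [df _] := f_smooth.
rewrite deriveE//.
rewrite {1}(row_sum_delta h) linear_sum /dot; apply: eq_bigr => i _.
by rewrite linearZ/= [grad f x _ _]mxE deriveE; [exact: mulrC|exact: df].
Qed.

(** The difference between f and its quadratic upper model has nonpositive
    derivative along the segment from x to x + h. *)
Lemma descent (x h : 'rV[R]_p) :
  f (x + h) <= f x + dot (grad f x) h + L / 2 * enorm h ^+ 2.
Proof.
have [df Lf] := f_smooth.
pose psi s := f (x + s *: h) -
  (s * dot (grad f x) h + L / 2 * enorm h ^+ 2 * s ^+ 2).
pose dpsi s := dot (grad f (x + s *: h)) h -
  (dot (grad f x) h + L * enorm h ^+ 2 * s).
have psi' (s : R) : is_derive s 1 psi (dpsi s).
  have dphi : is_derive s 1 (fun r : R => f (x + r *: h))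
      (dot (grad f (x + s *: h)) h).
    have dfh := @diff_derivable _ _ _ f _ h (df (x + s *: h)).
    rewrite -derive_dot_grad.
    (* both derivatives are limits of the same difference quotient *)
    have E :
        (fun t : R => t^-1 *: (f (x + (t *: 1 + s) *: h) - f (x + s *: h))) =
        (fun t : R => t^-1 *: (f (t *: h + (x + s *: h)) - f (x + s *: h))).
      by apply/funext => t; rewrite [t *: 1]mulr1 scalerDl addrCA.
    by split; rewrite /derivable /derive /= E.
  pose c2 := L / 2 * enorm h ^+ 2.
  have dquad : is_derive s 1 (fun r : R => r * dot (grad f x) h + c2 * r ^+ 2)
      (dot (grad f x) h + c2 * (2 * s)).
    have d1 := is_deriveZ (dot (grad f x) h) (is_derive_id s (1 : R)).
    have d2 := is_deriveZ c2 (is_deriveX 2 (is_derive_id s (1 : R))).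
    have -> : (fun r : R => r * dot (grad f x) h + c2 * r ^+ 2) =
        dot (grad f x) h \*: id + c2 \*: ((id : R -> R) ^+ 2).
      by apply/funext => r; rewrite [X in X + _ = _]mulrC.
    apply: is_derive_eq (is_deriveD d1 d2) _.
    by rewrite /GRing.scale/= expr1 !mulr1.
  rewrite /dpsi (_ : L * enorm h ^+ 2 * s = c2 * (2 * s)); last first.
    by rewrite /c2; field.
  exact: is_deriveB dphi dquad.
have [|c] := @MVT _ psi dpsi 0 1 ltr01 (fun c _ => psi' c).
  apply: continuous_subspaceT => s; apply: differentiable_continuous.
  by apply/derivable1_diffP; case: (psi' s).
rewrite in_itv/= => /andP[c0 c1].
rewrite /psi scale1r scale0r addr0 !mul0r expr0n/= !mulr0 expr1n mulr1 mul1r.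
move=> E.
have : dpsi c <= 0.
  rewrite /dpsi opprD addrA -dotBl subr_le0 (le_trans (dot_le_enorm _ _))//.
  have := Lf (x + c *: h) x.
  rewrite addrAC subrr add0r enormZ gtr0_norm// => Lc.
  rewrite (le_trans (ler_wpM2r (enorm_ge0 h) Lc))//.
  by rewrite le_eqVlt; apply/orP; left; apply/eqP; ring.
by move=> h0; move: E; rewrite addr0 !subr0 mulr1 => E; lra.
Qed.

Lemma continuous_grad i : continuous (fun x : 'rV[R]_p => grad f x ord0 i).
Proof.
have [_ Lf] := f_smooth.
move=> x; have FF : Filter (nbhs x) by exact: nbhs_filter.
apply/cvgrPdist_le => e e0.
have eL : 0 < e / L by rewrite divr_gt0.
have : (fun y => enorm (x - y)) @ x --> enorm (x - x).
  apply: (cvg_comp (fun y => x - y) (@enorm R p)); last exact: continuous_enorm.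
  by apply: cvgB; [exact: cvg_cst|exact: cvg_id].
have -> : enorm (x - x) = 0.
  by rewrite subrr -(scale0r 0) enormZ normr0 mul0r.
move=> /cvgrPdist_le /(_ _ eL); apply: filterS => y.
rewrite sub0r normrN ger0_norm ?enorm_ge0// ler_pdivlMr// mulrC => yx.
have := coord_le_enorm (grad f x - grad f y) i.
rewrite !mxE => /le_trans; apply.
exact: le_trans (Lf _ _) yx.
Qed.

Lemma continuous_smooth : continuous f.
Proof. by move=> x; apply: differentiable_continuous; have [] := f_smooth. Qed.

End smooth.

(** * Independence *)

Section independence.
Context d d1 d2 (Omega : measurableType d) (T1 : measurableType d1)
  (T2 : measurableType d2) (R : realType) (P : probability Omega R).
Local Open Scope ereal_scope.

Definition indep_fun (Z : Omega -> T1) (X : Omega -> T2) :=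
  forall A B, measurable A -> measurable B ->
    P (Z @^-1` A `&` X @^-1` B) = P (Z @^-1` A) * P (X @^-1` B).

(** Both sides are finite measures in C that agree on rectangles, by the
    joint independence of Z, X and the event E. *)
Lemma indep_event_pair (Z : Omega -> T1) (X : Omega -> T2) (E : set Omega) :
  measurable_fun setT Z -> measurable_fun setT X -> measurable E ->
  indep_fun Z X ->
  (forall A B, measurable A -> measurable B ->
    P (Z @^-1` A `&` X @^-1` B `&` E) = P (Z @^-1` A) * P (X @^-1` B) * P E) ->
  forall C, measurable C ->
    P ((fun w => (Z w, X w)) @^-1` C `&` E) =
    P ((fun w => (Z w, X w)) @^-1` C) * P E.
Proof.
move=> mZ mX mE ZX ZXE.
have mZX := measurable_fun_pair mZ mX.
pose f : {mfun Omega >-> (T1 * T2)%type} :=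
  HB.pack (fun w => (Z w, X w)) (isMeasurableFun.Build _ _ _ _ _ mZX).
have PE0 : (0 <= fine (P E))%R by rewrite fine_ge0.
pose law : {measure set (T1 * T2) -> \bar R} := pushforward (mrestr P mE) f.
pose m1 := law mZX.
pose m2 : {measure set (T1 * T2) -> \bar R} :=
  mscale (NngNum PE0) (distribution P f).
move=> C mC; transitivity (m2 C); last first.
  by rewrite /m2 /= /mscale /= fineK ?fin_num_measure// muleC.
rewrite -[LHS]/(m1 C).
pose G := [set A `*` B | A in @measurable _ T1 & B in @measurable _ T2].
apply: (@measure_unique _ R _ G (fun=> setT)) => //.
- by rewrite measurable_prod_measurableType.
- move=> _ _ [A mA [B mB <-]] [A' mA' [B' mB' <-]].
  exists (A `&` A'); first exact: measurableI.
  by exists (B `&` B'); [exact: measurableI|rewrite setXI].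
- move=> _; exists setT; first exact: measurableT.
  by exists setT; [exact: measurableT|exact: setXTT].
- by rewrite bigcup_const.
- move=> _ [A mA [B mB <-]].
  rewrite /m1 /law /m2 /= /mscale /pushforward /mrestr /=.
  rewrite fineK ?fin_num_measure//.
  by rewrite [LHS](ZXE _ _ mA mB) -ZX// muleC.
- move=> _; rewrite /m1 /law /= /pushforward /mrestr.
  by rewrite preimage_setT setTI -ge0_fin_numE// fin_num_measure.
Qed.

(** Tonelli with the joint law of (Z, X) written as a product law; keeping both
    integrals over the sample space avoids naming the marginal laws. *)
Lemma indep_ge0_integral (Z : Omega -> T1) (X : Omega -> T2)
    (f : T1 * T2 -> \bar R) :
  measurable_fun setT Z -> measurable_fun setT X -> indep_fun Z X ->
  measurable_fun setT f -> (forall z, 0 <= f z) ->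
  \int[P]_w f (Z w, X w) = \int[P]_w \int[P]_w' f (Z w, X w').
Proof.
move=> mZ mX ZX mf f0.
pose Zm : {mfun Omega >-> T1} := HB.pack Z (isMeasurableFun.Build _ _ _ _ _ mZ).
pose Xm : {mfun Omega >-> T2} := HB.pack X (isMeasurableFun.Build _ _ _ _ _ mX).
have mZX := measurable_fun_pair mZ mX.
pose g : {mfun Omega >-> (T1 * T2)%type} :=
  HB.pack (fun w => (Z w, X w)) (isMeasurableFun.Build _ _ _ _ _ mZX).
rewrite -[LHS](@ge0_integral_distribution _ _ _ _ _ P g)//.
transitivity (\int[distribution P Zm \x distribution P Xm]_z f z).
  apply: eq_measure_integral => C mC _; apply/esym.
  by apply: product_measure_unique => // A B mA mB; exact: ZX.
rewrite fubini_tonelli1//.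
rewrite (@ge0_integral_distribution _ _ _ _ _ P Zm).
- apply: eq_integral => w _.
  rewrite /= /fubini_F (@ge0_integral_distribution _ _ _ _ _ P Xm)//.
  exact: measurable_fun_pair2.
- exact: measurable_fun_fubini_tonelli_F.
- by move=> z; apply: integral_ge0.
Qed.

(** The induction needs more than the conclusion: Z_k must be independent of
    the whole future X_k, X_(k+1), ... at once. In the inductive step the event
    E of [indep_event_pair] is a constraint on the X_i with i > k. *)
Lemma indep_markov_chain N (X : nat -> Omega -> T2) (h : nat -> T1 * T2 -> T1)
    (z0 : T1) (Z : nat -> Omega -> T1) :
  (forall i, measurable_fun setT (X i)) ->
  (forall k, measurable_fun setT (h k)) ->
  (forall n (A : nat -> set T2), (n <= N)%N -> (forall i, measurable (A i)) ->
    P [set w | forall i, (i < n)%N -> A i (X i w)] =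
    \prod_(0 <= i < n) P (X i @^-1` A i)) ->
  Z 0%N = cst z0 -> (forall k w, Z k.+1 w = h k (Z k w, X k w)) ->
  forall k, measurable_fun setT (Z k) /\ ((k < N)%N -> indep_fun (Z k) (X k)).
Proof.
move=> mX mh indX Z0 ZS.
have mZ k : measurable_fun setT (Z k).
  elim: k => [|k IH]; first by rewrite Z0; exact: measurable_cst.
  rewrite (_ : Z k.+1 = h k \o (fun w => (Z k w, X k w))); last exact/funext.
  by apply: measurableT_comp => //; exact: measurable_fun_pair.
pose F k n (B : nat -> set T2) :=
  [set w | forall i, (k <= i < n)%N -> B i (X i w)].
have mF k n B : (forall i, measurable (B i)) -> measurable (F k n B).
  move=> mB; rewrite (_ : F k n B =
      \bigcap_(i in [set i | (k <= i < n)%N]) X i @^-1` B i); last first.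
    by apply/seteqP; split.
  apply: bigcap_measurableType => i _.
  exact: measurable_preimage.
have key k n A (B : nat -> set T2) : (k <= n)%N -> (n <= N)%N ->
    measurable A -> (forall i, measurable (B i)) ->
    P (Z k @^-1` A `&` F k n B) =
    P (Z k @^-1` A) * \prod_(k <= i < n) P (X i @^-1` B i).
  elim: k n A B => [|k IH] n A B kn nN mA mB.
    rewrite Z0 preimage_cst.
    case: ifPn => _; last by rewrite set0I measure0 mul0e.
    rewrite setTI probability_setT mul1e -indX//; congr (P _).
  (* constrain X_k by C and the later variables as B does *)
  pose B1 (C : set T2) i := if i == k then C else B i.
  have mB1 C : measurable C -> forall i, measurable (B1 C i).
    by move=> mC i; rewrite /B1; case: ifP.
  have FS C : F k n (B1 C) = X k @^-1` C `&` F k.+1 n B.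
    apply/seteqP; split => w /=.
      move=> H; split; first by have := H k; rewrite /B1 eqxx leqnn kn; apply.
      move=> i /andP[ki ni]; have := H i; rewrite /B1 gtn_eqF//.
      by rewrite ni (ltnW ki); apply.
    move=> [HC HF] i /andP[]; rewrite leq_eqVlt => /predU1P[<- _|ki ni].
      by rewrite /B1 eqxx.
    by rewrite /B1 gtn_eqF//; apply: HF; rewrite ki.
  have prodS C : \prod_(k <= i < n) P (X i @^-1` B1 C i) =
      P (X k @^-1` C) * \prod_(k.+1 <= i < n) P (X i @^-1` B i).
    rewrite big_ltn// {1}/B1 eqxx; congr (_ * _).
    by apply: eq_big_nat => i /andP[ki _]; rewrite /B1 gtn_eqF.
  have IHE A' C : measurable A' -> measurable C ->
      P (Z k @^-1` A' `&` (X k @^-1` C `&` F k.+1 n B)) =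
      P (Z k @^-1` A') *
        (P (X k @^-1` C) * \prod_(k.+1 <= i < n) P (X i @^-1` B i)).
    move=> mA' mC; rewrite -FS -prodS; apply: IH => //; first exact: ltnW.
    exact: mB1.
  have PF : P (F k.+1 n B) = \prod_(k.+1 <= i < n) P (X i @^-1` B i).
    have := IHE setT setT measurableT measurableT.
    by rewrite !preimage_setT !setTI probability_setT !mul1e.
  rewrite -PF.
  have ind : indep_fun (Z k) (X k).
    move=> A' C mA' mC.
    have := IH k.+1 A' (B1 C) (leqnSn k) (leq_trans kn nN) mA' (mB1 _ mC).
    rewrite big_nat1 /B1 eqxx => <-; congr (P (_ `&` _)).
    apply/seteqP; split => w /=.
      by move=> XC i; rewrite ltnS -eqn_leq eq_sym => /eqP ->; rewrite eqxx.
    by move=> /(_ k); rewrite leqnn ltnSn eqxx; apply.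
  have -> : Z k.+1 @^-1` A = (fun w => (Z k w, X k w)) @^-1` (h k @^-1` A).
    by apply/seteqP; split => w /=; rewrite ZS.
  apply: indep_event_pair => //.
  - exact: mF.
  - by move=> A' C mA' mC; rewrite -setIA IHE// PF muleA.
  - exact: measurable_preimage.
move=> k; split => // kN A B mA mB.
have := key k k.+1 A (fun=> B) (leqnSn k) kN mA (fun=> mB).
rewrite big_nat1 => <-; congr (P (_ `&` _)).
apply/seteqP; split => w /=.
  by move=> XC i; rewrite ltnS -eqn_leq eq_sym => /eqP ->.
by move=> /(_ k); rewrite leqnn ltnSn; apply.
Qed.

End independence.

(** * Normal laws on the line *)

Section gaussian.
Context {R : realType}.
Local Notation mu := (@lebesgue_measure R).
Implicit Types (m s a b c x y z : R) (A : set R).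

Lemma ge0_integral_normal_prob m s (f : R -> \bar R) :
  measurable_fun setT f -> (forall x, 0 <= f x)%E ->
  (\int[normal_prob m s]_x f x = \int[mu]_x (f x * (normal_pdf m s x)%:E))%E.
Proof.
move=> mf f0; have dom := @normal_prob_dominates R m s.
rewrite -(Radon_Nikodym_SigmaFinite.change_of_variables dom)//.
have pdfm : measurable_fun setT (fun x => (normal_pdf m s x)%:E).
  by apply/measurable_EFinP; exact: measurable_normal_pdf.
have RNm : measurable_fun setT
    (Radon_Nikodym_SigmaFinite.f (normal_prob m s) mu).
  exact: measurable_int (Radon_Nikodym_SigmaFinite.f_integrable dom).
apply: ae_eq_integral => //; [exact: emeasurable_funM|exact: emeasurable_funM|].
apply: ae_eqe_mul2l; apply: integral_ae_eq => //.
- exact: Radon_Nikodym_SigmaFinite.f_integrable.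
- by move=> E _ mE; rewrite -Radon_Nikodym_SigmaFinite.f_integral.
Qed.

Lemma lebesgue_measure_affine c a A : 0 < c -> measurable A ->
  (c%:E * mu ((fun x => (c * x + a)%R : measurableTypeR R) @^-1` A) = mu A)%E.
Proof.
move=> c0 mA.
have mf : measurable_fun [set: measurableTypeR R]
    (fun x => (c * x + a)%R : measurableTypeR R).
  exact: measurable_funD.
pose law : {measure set (measurableTypeR R) -> \bar R} :=
  pushforward mu (fun x => (c * x + a)%R : measurableTypeR R).
pose nu : {measure set (measurableTypeR R) -> \bar R} :=
  mscale (NngNum (ltW c0)) (law mf).
apply/esym; rewrite -[RHS]/(nu A).
apply: lebesgue_measure_unique => // _ [[u w]] _ <-.
rewrite /nu /= /mscale /= /law /pushforward /=.
have -> : (fun x => c * x + a) @^-1` `]u, w] =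
    `](u - a) / c, (w - a) / c]%classic.
  apply/seteqP; split => x; rewrite /= !in_itv/= ltr_pdivrMr// ler_pdivlMr//.
    by move=> /andP[? ?]; apply/andP; split; lra.
  by move=> /andP[? ?]; apply/andP; split; lra.
rewrite !lebesgue_measure_itv/= !lte_fin ltr_pM2r ?invr_gt0// ltrD2r.
case: ifPn => _; last by rewrite mule0.
by rewrite !EFinN -!EFinB -EFinM; congr (_%:E); field; rewrite gt_eqF.
Qed.

Lemma ge0_integral_affine c a (f : R -> \bar R) : 0 < c ->
  measurable_fun setT f -> (forall x, 0 <= f x)%E ->
  (c%:E * \int[mu]_x f (c * x + a)%R = \int[mu]_x f x)%E.
Proof.
move=> c0 mf f0.
have mg : measurable_fun [set: measurableTypeR R]
    (fun x => (c * x + a)%R : measurableTypeR R).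
  exact: measurable_funD.
rewrite -[X in (_ * X)%E](ge0_integral_pushforward mg mu measurableT mf)//.
pose law : {measure set (measurableTypeR R) -> \bar R} :=
  pushforward mu (fun x => (c * x + a)%R : measurableTypeR R).
rewrite -[X in (X * _)%E]/((NngNum (ltW c0))%:num%:E).
rewrite -(@ge0_integral_mscale _ _ R (law mg) setT measurableT
  (NngNum (ltW c0)) f)//.
apply: eq_measure_integral => A mA _.
exact: lebesgue_measure_affine.
Qed.

Lemma normal_peakE s : 0 < s -> normal_peak s = (s * Num.sqrt (2 * pi))^-1.
Proof.
move=> s0; rewrite /normal_peak -mulrnAr sqrtrM ?sqr_ge0// sqrtr_sqr.
by rewrite gtr0_norm// mulr_natl.
Qed.

Lemma normal_pdf_gt0E m s x : 0 < s ->
  normal_pdf m s x =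
  (s * Num.sqrt (2 * pi))^-1 * expR (- (x - m) ^+ 2 / (2 * s ^+ 2)).
Proof.
move=> s0; rewrite normal_pdfE ?gt_eqF// normal_peakE//.
by rewrite /normal_fun (mulr_natl (s ^+ 2)).
Qed.

Lemma sqrt2pi_gt0 : 0 < Num.sqrt (2 * pi) :> R.
Proof. by rewrite sqrtr_gt0 mulr_gt0// pi_gt0. Qed.

Lemma normal_prob_affine m s c a A : 0 < s -> 0 < c -> measurable A ->
  normal_prob m s ((fun x => c * x + a) @^-1` A) =
  normal_prob (c * m + a) (c * s) A.
Proof.
move=> s0 c0 mA.
pose f x := ((\1_A x)%:E * (normal_pdf (c * m + a) (c * s) x)%:E)%E.
have mf : measurable_fun setT f.
  apply: emeasurable_funM; apply/measurable_EFinP.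
    exact: measurable_indic.
  exact: measurable_normal_pdf.
have f0 x : (0 <= f x)%E by rewrite mule_ge0// lee_fin ?normal_pdf_ge0.
have mB : measurable ((fun x => c * x + a) @^-1` A).
  apply: measurable_preimage => //.
  exact: measurable_funD.
have step B m' s' : measurable B ->
    normal_prob m' s' B =
    (\int[mu]_x ((\1_B x)%:E * (normal_pdf m' s' x)%:E))%E.
  move=> mB'; rewrite -ge0_integral_normal_prob//.
    by rewrite integral_indic// setIT.
  by apply/measurable_EFinP; exact: measurable_indic.
rewrite (step _ _ _ mB) (step _ _ _ mA) -(ge0_integral_affine a c0 mf f0).
rewrite -ge0_integralZl//; last first.
- by rewrite lee_fin ltW.
- by apply: (measurableT_comp mf); apply: measurable_funD.
apply: eq_integral => x _; rewrite /f muleCA; congr (_ * _)%E.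
rewrite -EFinM; congr (_%:E); rewrite !normal_pdf_gt0E ?mulr_gt0//.
have -> : - (c * x + a - (c * m + a)) ^+ 2 / (2 * (c * s) ^+ 2) =
          - (x - m) ^+ 2 / (2 * s ^+ 2).
  by field; rewrite !gt_eqF.
have h := sqrt2pi_gt0.
by rewrite [RHS]mulrA; congr (_ * _); field; rewrite !gt_eqF.
Qed.

Lemma normal_prob_opp s A : 0 < s -> measurable A ->
  normal_prob 0 s (-%R @^-1` A) = normal_prob 0 s A.
Proof.
move=> s0 mA.
have mN :
    measurable_fun [set: measurableTypeR R] (-%R : _ -> measurableTypeR R).
  exact: oppr_measurable.
rewrite /normal_prob.
transitivity (\int[mu]_(x in -%R @^-1` A) (normal_pdf 0 s (- x))%:E)%E.
  apply: eq_integral => x _; congr (_%:E).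
  by rewrite !normal_pdf_gt0E// !subr0 sqrrN.
have mp : measurable_fun A (fun x => (normal_pdf 0 s x)%:E).
  by apply/measurable_funTS/measurable_EFinP; exact: measurable_normal_pdf.
rewrite -(ge0_integral_pushforward mN mu mA mp); last first.
  by move=> x _; rewrite lee_fin normal_pdf_ge0.
apply: eq_measure_integral => B mB _.
exact: lebesgue_measureN.
Qed.

(** Adding a normal variable of deviation b to a centered one of deviation a.
    After exchanging the integrals, completing the square turns the joint
    density of the mean x and the value z into the density of deviation c at z
    times a normal density in x, whose integral is 1. *)
Lemma normal_prob_conv a b c A : 0 < a -> 0 < b -> 0 < c ->
  c ^+ 2 = a ^+ 2 + b ^+ 2 -> measurable A ->
  (\int[normal_prob 0 a]_x normal_prob x b A = normal_prob 0 c A)%E.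
Proof.
move=> a0 b0 c0 cab mA.
pose g (xz : R * R) := (normal_pdf 0 a xz.1 * normal_pdf xz.1 b xz.2)%:E.
have mpdf2 : measurable_fun setT (fun xz : R * R => normal_pdf xz.1 b xz.2).
  rewrite (_ : (fun xz => _) =
      normal_pdf 0 b \o (fun xz : R * R => xz.2 - xz.1)).
    apply: measurableT_comp; first exact: measurable_normal_pdf.
    exact: measurable_funB.
  by apply/funext => x; rewrite /= !normal_pdf_gt0E// subr0.
have mg : measurable_fun setT g.
  apply/measurable_EFinP; apply: measurable_funM => //.
  by apply: measurableT_comp => //; exact: measurable_normal_pdf.
have g0 xz : (0 <= g xz)%E by rewrite lee_fin mulr_ge0// normal_pdf_ge0.
pose f (xz : R * R) := (g xz * (\1_A xz.2)%:E)%E.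
have m1A : measurable_fun setT (fun xz : R * R => (\1_A xz.2)%:E : \bar R).
  have mi : measurable_fun setT (\1_A : R -> R) by exact: measurable_indic.
  by apply/measurable_EFinP; exact: (measurableT_comp mi measurable_snd).
have mf : measurable_fun setT f by exact: emeasurable_funM.
have f0 xz : (0 <= f xz)%E by rewrite mule_ge0// lee_fin.
transitivity (\int[mu]_x \int[mu]_z f (x, z))%E.
  rewrite ge0_integral_normal_prob//.
    apply: eq_integral => x _; rewrite /f /g /= /normal_prob.
    rewrite integral_mkcond muleC -ge0_integralZl//.
    + apply: eq_integral => z _; rewrite EFinM -muleA; congr (_ * _)%E.
      by rewrite patchE indicE; case: (z \in A); rewrite ?mule1 ?mule0.
    + apply/measurable_restrict => //; apply/measurable_funTS/measurable_EFinP.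
      exact: measurable_normal_pdf.
    + move=> z _; rewrite patchE; case: ifP => // _.
      by rewrite lee_fin normal_pdf_ge0.
    + by rewrite lee_fin normal_pdf_ge0.
  have <- : fubini_F mu (fun xz : R * R =>
        ((normal_pdf xz.1 b xz.2)%:E * (\1_A xz.2)%:E)%E) =
      (fun x => normal_prob x b A).
    apply/funext => x; rewrite /fubini_F /normal_prob [RHS]integral_mkcond.
    apply: eq_integral => z _ /=.
    by rewrite patchE indicE; case: (z \in A); rewrite ?mule1 ?mule0.
  apply: measurable_fun_fubini_tonelli_F => //.
  by apply: emeasurable_funM => //; apply/measurable_EFinP.
  by move=> xz; rewrite mule_ge0// lee_fin normal_pdf_ge0.
rewrite (@fubini_tonelli _ _ _ _ R mu mu f mf f0) /normal_prob.
rewrite [RHS]integral_mkcond.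
apply: eq_integral => z _; rewrite /f /=.
rewrite ge0_integralZr//; last exact: measurable_fun_pair1.
transitivity ((normal_pdf 0 c z)%:E * (\1_A z)%:E)%E; last first.
  by rewrite patchE indicE; case: (z \in A); rewrite ?mule1 ?mule0.
congr (_ * _)%E.
have abc : 0 < a * b / c by rewrite divr_gt0 ?mulr_gt0.
(* mean and deviation of x given z *)
transitivity (\int[mu]_x ((normal_pdf 0 c z)%:E *
    (normal_pdf (a ^+ 2 / c ^+ 2 * z) (a * b / c) x)%:E))%E; last first.
  rewrite ge0_integralZl//.
  - by rewrite integral_normal_pdf mule1.
  - by apply/measurable_EFinP; exact: measurable_normal_pdf.
  - by move=> x _; rewrite lee_fin normal_pdf_ge0.
  - by rewrite lee_fin normal_pdf_ge0.
apply: eq_integral => x _; rewrite /g /= -EFinM; congr (_%:E).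
rewrite !normal_pdf_gt0E// !subr0 mulrACA [RHS]mulrACA -!expRD.
have h := sqrt2pi_gt0.
congr (_ * expR _); first by field; rewrite !gt_eqF.
rewrite expr_div_n exprMn cab; field.
by rewrite !gt_eqF// addr_gt0// exprn_gt0.
Qed.

(** By symmetry this is the integral of x times the density over the positive
    half-line, and - s^2 times the density is a primitive. *)
Lemma normal_prob_neg_part s : 0 < s ->
  (\int[normal_prob 0 s]_x (Num.max 0 (- x))%:E = (s / Num.sqrt (2 * pi))%:E)%E.
Proof.
move=> s0; have h := sqrt2pi_gt0.
pose K := s / Num.sqrt (2 * pi).
pose F x := - K * expR (- (x ^+ 2 / (2 * s ^+ 2))).
have mmax : measurable_fun setT (fun x : R => (Num.max 0 (- x))%:E).
  by apply/measurable_EFinP; exact: measurable_maxr.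
rewrite ge0_integral_normal_prob//; last first.
  by move=> x; rewrite lee_fin le_max lexx.
have dF x : is_derive x 1 F (x * normal_pdf 0 s x).
  pose k := - (2 * s ^+ 2)^-1.
  have dq : is_derive x 1 (fun y : R => k * y ^+ 2) (k * (2 * x)).
    have := is_deriveZ k (is_deriveX 2 (is_derive_id x (1 : R))).
    by rewrite /GRing.scale/= expr1 mulr1.
  have dexp : is_derive x 1 F (- K * (expR (k * x ^+ 2) * (k * (2 * x)))).
    have := is_deriveZ (- K) (is_derive1_comp (is_derive_expR _) dq).
    rewrite (_ : _ \*: _ = F)//; apply/funext => y.
    by rewrite /F /=; congr (_ * expR _); rewrite /k mulNr mulrC.
  apply: is_derive_eq dexp _; rewrite normal_pdf_gt0E// subr0.
  have -> : - x ^+ 2 / (2 * s ^+ 2) = k * x ^+ 2 by rewrite /k !mulNr mulrC.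
  by rewrite /K /k; field; rewrite !gt_eqF.
have Foo : F x @[x --> +oo] --> (0 : R).
  rewrite -[X in _ --> X](mulr0 (- K)); apply: cvgMr.
  apply: (cvg_comp (fun x => x ^+ 2 / (2 * s ^+ 2)) (fun x => expR (- x)));
    last exact: cvgr_expR.
  apply: gt0_cvgMly; last exact: cvgr_expr2.
  by rewrite invr_gt0 mulr_gt0// exprn_gt0.
have mf : measurable_fun setT
    (fun x : R => (Num.max 0 x * normal_pdf 0 s x)%:E).
  apply/measurable_EFinP; apply: measurable_funM; first exact: measurable_maxr.
  exact: measurable_normal_pdf.
have f0 x : (0 <= (Num.max 0 x * normal_pdf 0 s x)%:E)%E.
  by rewrite lee_fin mulr_ge0// ?normal_pdf_ge0// le_max lexx.
transitivity (\int[mu]_(x in `[0%R, +oo[)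
    (Num.max 0 x * normal_pdf 0 s x)%:E)%E.
  rewrite (ge0_integration_by_substitution0 mf f0) [RHS]integral_mkcond.
  apply: eq_integral => x _; rewrite patchE mem_setE in_itv/=.
  have [x0|x0] := leP x 0; last by rewrite max_l ?mul0e// oppr_le0 ltW.
  by rewrite -EFinM !normal_pdf_gt0E// !subr0 sqrrN.
transitivity (\int[mu]_(x in `[0%R, +oo[) (x * normal_pdf 0 s x)%:E)%E.
  apply: eq_integral => x; rewrite mem_setE in_itv/= andbT => x0.
  by rewrite max_r.
rewrite (@ge0_continuous_FTC2y _ _ F 0 0)//.
- by rewrite /F expr0n/= mul0r oppr0 expR0 mulr1 -EFinB sub0r opprK.
- by move=> x x0; rewrite mulr_ge0// normal_pdf_ge0.
- apply: continuous_subspaceT => x; apply: cvgM => //.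
  by apply: continuous_normal_pdf; rewrite gt_eqF.
- apply: cvg_at_right_filter; apply: differentiable_continuous.
  by apply/derivable1_diffP.
- by move=> x _; rewrite derive1E derive_val.
Qed.

(** The second moment comes from comparing total masses only. For r > 1 and
    Y = x^2 / (2 s^2), convexity of exp gives
      (1 + (1 - 1 / r^2) Y) exp (- Y) <= exp (- Y / r^2),
    whose right-hand side is the unnormalized density of deviation r s, with r
    times the mass of exp (- Y). Integrating bounds the second moment by
    2 s^2 r^2 / (r + 1) <= s^2 r^2, and r can be taken arbitrarily close to 1. *)
Lemma normal_prob_sqr s : 0 < s ->
  (\int[normal_prob 0 s]_x (x ^+ 2)%:E <= (s ^+ 2)%:E)%E.
Proof.
move=> s0.
have msqr : measurable_fun setT (fun x : R => (x ^+ 2)%:E).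
  by apply/measurable_EFinP; exact: measurable_funX.
have step r : 1 < r ->
    (\int[normal_prob 0 s]_x (x ^+ 2)%:E <= (s ^+ 2 * r ^+ 2)%:E)%E.
  move=> r1; have r0 : 0 < r by rewrite (lt_trans _ r1).
  pose h := 1 - r^-2.
  have h0 : 0 < h by rewrite subr_gt0 invf_lt1 ?exprn_gt0// exprn_egt1.
  have rs0 : 0 < r * s by rewrite mulr_gt0.
  pose H x := ((h / (2 * s ^+ 2))%:E * (x ^+ 2)%:E + 1%:E)%E.
  have mH : measurable_fun setT H.
    by apply: emeasurable_funD => //; apply: emeasurable_funM.
  have H0 x : (0 <= H x)%E.
    rewrite adde_ge0// mule_ge0// lee_fin ?sqr_ge0//.
    by rewrite divr_ge0 ?ltW// mulr_gt0// exprn_gt0.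
  have mono : (\int[normal_prob 0 s]_x H x <= r%:E)%E.
    rewrite ge0_integral_normal_prob//.
    have -> : (r%:E = \int[mu]_x (r%:E * (normal_pdf 0 (r * s) x)%:E))%E.
      rewrite ge0_integralZl//; first by rewrite integral_normal_pdf mule1.
      + by apply/measurable_EFinP; exact: measurable_normal_pdf.
      + by move=> x _; rewrite lee_fin normal_pdf_ge0.
      + by rewrite lee_fin ltW.
    apply: ge0_le_integral => //.
    + by move=> x _; rewrite mule_ge0// lee_fin normal_pdf_ge0.
    + apply: emeasurable_funM => //; apply/measurable_EFinP.
      exact: measurable_normal_pdf.
    + apply: emeasurable_funM => //; apply/measurable_EFinP.
      exact: measurable_normal_pdf.
    + move=> x _; rewrite /H -!EFinM lee_fin !normal_pdf_gt0E// !subr0.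
      pose Y := x ^+ 2 / (2 * s ^+ 2).
      have -> : h / (2 * s ^+ 2) * x ^+ 2 + 1 = 1 + h * Y.
        by rewrite /Y; field; rewrite gt_eqF.
      have -> : - x ^+ 2 / (2 * s ^+ 2) = - Y by rewrite /Y mulNr.
      have -> : - x ^+ 2 / (2 * (r * s) ^+ 2) = h * Y - Y.
        by rewrite /Y /h; field; rewrite !gt_eqF.
      rewrite expRD mulrCA mulrA.
      have -> : r * ((r * s * Num.sqrt (2 * pi))^-1 *
            (expR (h * Y) * expR (- Y))) =
          (s * Num.sqrt (2 * pi))^-1 * expR (h * Y) * expR (- Y).
        by have hp := sqrt2pi_gt0; field; rewrite !gt_eqF.
      rewrite ler_wpM2r ?expR_ge0// ler_wpM2l ?expR_ge1Dx//.
      by rewrite invr_ge0 mulr_ge0 ?ltW// sqrt2pi_gt0.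
  have cpos : 0 < h / (2 * s ^+ 2) by rewrite divr_gt0// mulr_gt0// exprn_gt0.
  move: mono; rewrite /H ge0_integralD//; last 2 first.
  + by move=> x _; rewrite mule_ge0// lee_fin ?sqr_ge0// ltW.
  + exact: emeasurable_funM.
  rewrite ge0_integralZl//; last 2 first.
  + by move=> x _; rewrite lee_fin sqr_ge0.
  + by rewrite lee_fin ltW.
  rewrite integral_cst// mul1e.
  rewrite [X in (_ + X)%E](probability_setT (normal_prob 0 s)).
  rewrite -leeBrDr// -EFinB muleC -lee_pdivlMr// -EFinM => /le_trans; apply.
  rewrite lee_fin.
  have -> : (r - 1) / (h / (2 * s ^+ 2)) = 2 * s ^+ 2 * r ^+ 2 / (r + 1).
    rewrite /h; field.
    have : 1 < r ^+ 2 by rewrite exprn_egt1.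
    by move=> r21; rewrite !gt_eqF//; lra.
  have ? := mulr_gt0 (exprn_gt0 2 s0) (exprn_gt0 2 r0).
  rewrite ler_pdivrMr ?addr_gt0//; nra.
apply/lee_addgt0Pr => e e0.
have s20 : 0 < s ^+ 2 by rewrite exprn_gt0.
(* the r for which s^2 r^2 = s^2 + e *)
have := step (Num.sqrt (1 + e / s ^+ 2)).
have es : 0 < e / s ^+ 2 by rewrite divr_gt0.
rewrite sqr_sqrtr; last by rewrite ltW// ltr_pwDl// ltW.
rewrite -[X in X < _]sqrtr1 ltr_sqrt; last by rewrite ltr_pwDl// ltW.
rewrite ltrDl => /(_ es); rewrite -EFinD.
by rewrite mulrDr mulr1 mulrCA divff ?mulr1// gt_eqF.
Qed.

End gaussian.

(** * Normal random variables and isotropic vectors *)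

Section gaussian_variables.
Context d (Omega : measurableType d) (R : realType) (P : probability Omega R).
Implicit Types (X Y : Omega -> R) (s : R).

Definition centered_normal s X := forall A, measurable A ->
  P (X @^-1` A) = normal_prob 0 s A.

Lemma centered_normal_scale X s c : 0 < s -> c != 0 ->
  centered_normal s X -> centered_normal (`|c| * s) (fun w => c * X w).
Proof.
move=> s0 c0 NX A mA.
have pos b : 0 < b -> forall Y, centered_normal s Y ->
    P ((fun w => b * Y w) @^-1` A) = normal_prob 0 (b * s) A.
  move=> b0 Y NY.
  have := normal_prob_affine 0 0 s0 b0 mA; rewrite mulr0 addr0 => <-.
  rewrite -NY; first by congr (P _); apply/seteqP; split => w /=; rewrite addr0.
  by apply: measurable_preimage => //; exact: measurable_funD.
have [cp|cn|c00] := ltrgt0P c; last by move: c0; rewrite c00 eqxx.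
- by rewrite pos.
- have c0' : 0 < - c by rewrite oppr_gt0.
  rewrite -(pos _ c0' (fun w => - X w)); last first.
    move=> B mB; rewrite -normal_prob_opp// -NX//.
    by apply: measurable_preimage => //; exact: oppr_measurable.
  by congr (P _); apply/seteqP; split => w /=; rewrite mulrNN.
Qed.

Lemma centered_normal_add X Y a b c : 0 < a -> 0 < b -> 0 < c ->
  c ^+ 2 = a ^+ 2 + b ^+ 2 ->
  measurable_fun setT X -> measurable_fun setT Y -> indep_fun P X Y ->
  centered_normal a X -> centered_normal b Y ->
  centered_normal c (X \+ Y).
Proof.
move=> a0 b0 c0 cab mX mY XY NX NY A mA.
rewrite -(normal_prob_conv a0 b0 c0 cab mA).
pose f (xy : R * R) := (\1_A (xy.1 + xy.2))%:E : \bar R.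
have mi : measurable_fun setT (\1_A : R -> R) by exact: measurable_indic.
have mf : measurable_fun setT f.
  apply/measurable_EFinP; apply: (measurableT_comp mi).
  exact: measurable_funD.
have f0 z : (0 <= f z)%E by rewrite lee_fin.
have mXY : measurable ((X \+ Y) @^-1` A).
  by apply: measurable_preimage => //; exact: measurable_funD.
transitivity (\int[P]_w f (X w, Y w))%E.
  by rewrite -[(X \+ Y) @^-1` A]setIT -integral_indic.
rewrite (indep_ge0_integral mX mY XY mf f0).
have inner x : (\int[P]_w f (x, Y w) = normal_prob x b A)%E.
  have mA' : measurable ((fun y => 1 * y + x) @^-1` A).
    by apply: measurable_preimage => //; exact: measurable_funD.
  have := normal_prob_affine 0 x b0 ltr01 mA; rewrite mulr0 add0r mul1r => <-.
  rewrite -NY// -[X in P X]setIT -integral_indic//; last first.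
    exact: measurable_preimage.
  apply: eq_integral => w _; rewrite /f !indicE/=; congr (nat_of_bool _)%:R%:E.
  by apply/idP/idP; rewrite !inE /= mul1r addrC.
under eq_integral do rewrite inner.
(* normal_prob is a measure on measurableTypeR R, a copy of R, so the law of
   X has to be taken there *)
have mX' : measurable_fun setT (X : Omega -> measurableTypeR R) by exact: mX.
pose Xm : {mfun Omega >-> measurableTypeR R} :=
  HB.pack X (isMeasurableFun.Build _ _ _ _ _ mX').
have mN : measurable_fun setT (fun x => normal_prob x b A : \bar R).
  rewrite (_ : (fun x => _) = (fun x => \int[P]_w f (x, Y w))%E); last first.
    by apply/funext => x; rewrite inner.
  pose Ym : {mfun Omega >-> R} :=
    HB.pack Y (isMeasurableFun.Build _ _ _ _ _ mY).
  rewrite (_ : (fun x => _) = fubini_F (distribution P Ym) f).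
    exact: measurable_fun_fubini_tonelli_F.
  apply/funext => x; rewrite /fubini_F.
  rewrite (@ge0_integral_distribution _ _ _ _ _ P Ym)//.
  exact: measurable_fun_pair2.
transitivity (\int[distribution P Xm]_x normal_prob x b A)%E.
  apply/esym; apply: (ge0_integral_distribution Xm mN) => y.
  by rewrite -inner; exact: integral_ge0.
by apply: eq_measure_integral => B mB _; exact: NX.
Qed.

Lemma centered_normal_integral s X (f : R -> \bar R) : measurable_fun setT X ->
  centered_normal s X -> measurable_fun setT f -> (forall x, 0 <= f x)%E ->
  (\int[P]_w f (X w) = \int[normal_prob 0 s]_x f x)%E.
Proof.
move=> mX NX mf f0.
(* normal_prob is a measure on measurableTypeR R, a copy of R, so the law of
   X has to be taken there *)
have mX' : measurable_fun setT (X : Omega -> measurableTypeR R) by exact: mX.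
pose Xm : {mfun Omega >-> measurableTypeR R} :=
  HB.pack X (isMeasurableFun.Build _ _ _ _ _ mX').
rewrite -[LHS](ge0_integral_distribution Xm mf f0).
by apply: eq_measure_integral => B mB _; exact: NX.
Qed.

End gaussian_variables.

Section isotropic_vector.
Context d (Omega : measurableType d) (R : realType) (P : probability Omega R)
  (q : nat).
Local Notation p := q.+1.
Variables (s2 : R) (V : {RV P >-> borel_rV R p}).
Hypotheses (s2_gt0 : 0 < s2) (V_normal : isotropic_normal s2 V).
Local Notation s := (Num.sqrt s2).
Let X (i : nat) (w : Omega) : R := (V w : 'rV[R]_p) ord0 (inord i).

Let s_gt0 : 0 < s. Proof. by rewrite sqrtr_gt0. Qed.

Let mX i : measurable_fun setT (X i).
Proof.
exact: (measurableT_comp (@measurable_coord_rV R p (inord i))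
  (measurable_funPT V)).
Qed.

Let X_law i : centered_normal P s (X i).
Proof.
move=> A mA.
pose B (j : 'I_p) := if j == inord i then A else setT.
have mB j : measurable (B j) by rewrite /B; case: ifP.
have := V_normal mB.
rewrite (bigD1 (inord i))//= big1 ?mule1 => [|j ji]; last first.
  by rewrite /B (negbTE ji); exact: (probability_setT (normal_prob 0 s)).
rewrite /B eqxx => <-; congr (P _); apply/seteqP; split => w /=.
  by move=> Aw j; case: ifPn => // /eqP ->.
by move=> /(_ (inord i)); rewrite eqxx.
Qed.

Let X_indep n (A : nat -> set R) : (n <= p)%N -> (forall i, measurable (A i)) ->
  P [set w | forall i, (i < n)%N -> A i (X i w)] =
  (\prod_(0 <= i < n) P (X i @^-1` A i))%E.
Proof.
move=> np mA.
pose B (j : 'I_p) := if (j < n)%N then A j else setT.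
have mB j : measurable (B j) by rewrite /B; case: ifP.
rewrite (big_nat_widen _ _ p)//= big_mkcond/= big_mkord.
transitivity (\prod_(j < p) normal_prob 0 s (B j))%E.
  rewrite -V_normal//; congr (P _); apply/seteqP; split => w /=.
    move=> Aw j; rewrite /B; case: ifPn => // jn.
    by have := Aw j jn; rewrite /X inord_val.
  move=> Bw i ni; have ip : (i < p)%N by rewrite (leq_trans ni).
  by have := Bw (inord i); rewrite /B inordK// ni.
apply: eq_bigr => j _; rewrite /B; case: ifPn => jn.
  by rewrite X_law.
exact: (probability_setT (normal_prob 0 s)).
Qed.

Let S (g : 'rV[R]_p) (k : nat) (w : Omega) : R :=
  \sum_(0 <= i < k) g ord0 (inord i) * X i w.

Let S_dot g w : S g p w = dot g (V w).
Proof.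
by rewrite /S big_mkord; apply: eq_bigr => i _; rewrite /X !inord_val.
Qed.

Let S_chain g k : measurable_fun setT (S g k) /\
  ((k < p)%N -> indep_fun P (S g k) (X k)).
Proof.
apply: (@indep_markov_chain _ _ _ Omega R R R P p X
  (fun k zx => zx.1 + g ord0 (inord k) * zx.2) 0) => //.
- move=> i; apply: measurable_funD => //.
  by apply: measurable_funM => //.
- by apply/funext => w; rewrite /S big_geq.
- by move=> i w; rewrite /S big_nat_recr.
Qed.

(** While the first coordinates of g vanish, S g k is identically 0, and
    normal_prob 0 0 is not the Dirac mass: this case is kept apart. *)
Let S_law (g : 'rV[R]_p) k : (k <= p)%N ->
  let n2 := \sum_(0 <= i < k) g ord0 (inord i) ^+ 2 in
  (n2 = 0 /\ forall w, S g k w = 0) \/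
  (0 < n2 /\ centered_normal P (s * Num.sqrt n2) (S g k)).
Proof.
elim: k => [_ /=|k IH kp /=].
  by left; rewrite big_geq//; split => // w; rewrite /S big_geq.
have [mS indS] := S_chain g k.
have SE w : S g k.+1 w = S g k w + g ord0 (inord k) * X k w.
  by rewrite /S big_nat_recr.
rewrite big_nat_recr//=; set c := g ord0 (inord k).
have {IH} := IH (ltnW kp); set n2 := \sum_(0 <= i < k) _ => IH.
have [c0|c0] := eqVneq c 0.
  rewrite c0 expr0n addr0.
  have -> // : S g k.+1 = S g k.
  by apply/funext => w; rewrite SE -/c c0 mul0r addr0.
have c20 : 0 < c ^+ 2 by rewrite exprn_even_gt0.
have cX := centered_normal_scale s_gt0 c0 (X_law k).
case: IH => [[-> S0]|[n20 NS]]; right; split.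
- by rewrite add0r.
- rewrite add0r sqrtr_sqr mulrC.
  have -> // : S g k.+1 = (fun w => c * X k w).
  by apply/funext => w; rewrite SE S0 add0r.
- by rewrite addr_gt0.
- have -> : S g k.+1 = S g k \+ (fun w => c * X k w).
    by apply/funext => w; rewrite SE.
  apply: centered_normal_add NS cX => //.
  + by rewrite mulr_gt0// sqrtr_gt0.
  + by rewrite mulr_gt0// normr_gt0.
  + by rewrite mulr_gt0// sqrtr_gt0 addr_gt0.
  + rewrite !exprMn !sqr_sqrtr ?(ltW s2_gt0) ?(ltW n20) ?ltW ?addr_gt0//.
    by rewrite real_normK ?num_real//; ring.
  + exact: measurable_funM.
  + move=> A B mA mB.
    have mB' : measurable ((fun x => c * x) @^-1` B).
      by apply: measurable_preimage => //; exact: measurable_funM.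
    by have := indS kp A _ mA mB'.
Qed.

(** <g, V> has deviation |g| s, and [normal_prob_neg_part] applies. *)
Lemma dot_neg_part_expectation (g : 'rV[R]_p) :
  (\int[P]_w (Num.max 0 (- dot g (V w)))%:E =
   (enorm g * (s / Num.sqrt (2 * pi)))%:E)%E.
Proof.
have n2E : \sum_(0 <= i < p) g ord0 (inord i) ^+ 2 = \sum_(i < p) g ord0 i ^+ 2.
  by rewrite big_mkord; apply: eq_bigr => i _; rewrite inord_val.
rewrite /enorm; have /= := S_law g (leqnn p); rewrite n2E.
case=> [[-> S0]|[n20 NS]].
  rewrite sqrtr0 mul0r; apply: integral0_eq => w _.
  by rewrite -S_dot S0 oppr0 maxxx.
have [mS _] := S_chain g p.
under eq_integral do rewrite -S_dot.
rewrite (centered_normal_integral mS NS (f := fun x => (Num.max 0 (- x))%:E)).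
- rewrite normal_prob_neg_part ?mulr_gt0 ?sqrtr_gt0//.
  by congr (_%:E); rewrite mulrA (mulrC s).
- by apply/measurable_EFinP; exact: measurable_maxr.
- by move=> x; rewrite lee_fin le_max lexx.
Qed.

Lemma enorm_sqr_expectation :
  (\int[P]_w (enorm (V w) ^+ 2)%:E <= (p%:R * s2)%:E)%E.
Proof.
under eq_integral do rewrite sqr_enorm_sum -sumEFin.
rewrite ge0_integral_sum//; last 2 first.
- move=> i; apply/measurable_EFinP; apply: measurable_funX.
  exact: (measurableT_comp (@measurable_coord_rV R p i) (measurable_funPT V)).
- by move=> i w _; rewrite lee_fin sqr_ge0.
apply: (@le_trans _ _ (\sum_(i < p) s2%:E)%E); last first.
  by rewrite sumEFin sumr_const card_ord mulr_natl.
apply: lee_sum => i _.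
have sqr_le := normal_prob_sqr s_gt0.
rewrite (sqr_sqrtr (ltW s2_gt0)) in sqr_le.
apply: le_trans sqr_le.
rewrite -(centered_normal_integral (mX i) (X_law i)
  (f := fun x => (x ^+ 2)%:E)).
- by under [leRHS]eq_integral do rewrite /X inord_val.
- by apply/measurable_EFinP; exact: measurable_funX.
- by move=> x; rewrite lee_fin sqr_ge0.
Qed.

Let mNV :
  measurable_fun setT (fun w => - (V w : 'rV[R]_p) : borel_rV R p).
Proof.
apply: measurable_fun_rV => i.
rewrite (_ : (fun w => _) = (fun w => - (V w : 'rV[R]_p) ord0 i)).
  apply: measurable_funN.
  exact: (measurableT_comp (@measurable_coord_rV R p i) (measurable_funPT V)).
by apply/funext => w; rewrite mxE.
Qed.

Let V_sym (f : borel_rV R p -> \bar R) :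
  measurable_fun setT f -> (forall x, 0 <= f x)%E ->
  (\int[P]_w f (V w) = \int[P]_w f (- (V w : 'rV[R]_p))%R)%E.
Proof.
pose W : {RV P >-> borel_rV R p} :=
  HB.pack (fun w => - (V w : 'rV[R]_p) : borel_rV R p)
    (isMeasurableFun.Build _ _ _ _ _ mNV).
move=> mf f0.
rewrite -[LHS](ge0_integral_distribution V mf f0).
rewrite -[RHS](ge0_integral_distribution W mf f0).
apply: eq_measure_integral => B mB _.
apply: box_measure_unique mB => A mA.
rewrite [LHS](V_normal mA).
transitivity (distribution P V (box (fun i => -%R @^-1` A i))).
  rewrite [RHS](V_normal (A := fun i => -%R @^-1` A i)).
    by apply: eq_bigr => i _; rewrite normal_prob_opp.
  by move=> i; apply: measurable_preimage => //; exact: oppr_measurable.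
rewrite /distribution /pushforward; congr (P _).
by apply/seteqP; split => w /= H i; have := H i; rewrite /= mxE.
Qed.

Let measurable_dot (g : 'rV[R]_p) :
  measurable_fun setT (fun x : borel_rV R p => dot g x).
Proof.
apply: measurable_sum => i; apply: measurable_funM => //.
exact: measurable_coord_rV.
Qed.

(** The half-spaces <g, x> < 0 and <g, - x> < 0 are disjoint and have the same
    contribution. *)
Lemma enorm_sqr_halfspace_expectation (g : 'rV[R]_p) :
  (\int[P]_w (if dot g (V w) < 0 then enorm (V w) ^+ 2 else 0)%:E <=
   (p%:R * s2 / 2)%:E)%E.
Proof.
pose f (x : borel_rV R p) : \bar R :=
  (if dot g x < 0 then enorm x ^+ 2 else 0)%:E.
have mf : measurable_fun setT f.
  apply/measurable_EFinP; apply: measurable_fun_ifT => //.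
    exact: measurable_fun_ltr.
  by apply: measurable_funX; exact: measurable_enorm.
have f0 x : (0 <= f x)%E by rewrite lee_fin; case: ifP; rewrite ?sqr_ge0.
have mfV : measurable_fun setT (fun w => f (V w)).
  exact: (measurableT_comp mf (measurable_funPT V)).
have mfNV : measurable_fun setT (fun w => f (- (V w : 'rV[R]_p))).
  exact: (measurableT_comp mf mNV).
have twice : (\int[P]_w f (V w) + \int[P]_w f (V w) <= (p%:R * s2)%:E)%E.
  rewrite {2}(V_sym mf f0) -ge0_integralD//.
  apply: le_trans enorm_sqr_expectation; apply: ge0_le_integral => //.
  - by move=> w _; rewrite adde_ge0.
  - exact: emeasurable_funD.
  - apply/measurable_EFinP; apply: measurable_funX.
    exact: (measurableT_comp measurable_enorm (measurable_funPT V)).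
  - move=> w _; rewrite /f -EFinD lee_fin.
    have -> : dot g (- (V w : 'rV[R]_p)) = - dot g (V w).
      by rewrite /dot -sumrN; apply: eq_bigr => i _; rewrite mxE mulrN.
    have -> : enorm (- (V w : 'rV[R]_p)) = enorm (V w).
      by rewrite -scaleN1r enormZ normrN1 mul1r.
    rewrite oppr_lt0.
    case: (ltrgt0P (dot g (V w))) => _; rewrite ?addr0 ?add0r//.
    exact: sqr_ge0.
rewrite -/f; set I := (\int[P]_w f (V w))%E in twice *.
have -> : (p%:R * s2 / 2)%:E = (2^-1%:E * (p%:R * s2)%:E)%E.
  by rewrite -EFinM mulrC.
by rewrite lee_pdivlMl// -[2]/(1 + 1) EFinD ge0_muleDl// !mul1e.
Qed.

End isotropic_vector.

(** * Step sizes *)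

Section scalar.
Context {R : realType}.
Implicit Types (A x L eps W : R).

Lemma sum_inv_odd_le n : (0 < n)%N ->
  \sum_(0 <= k < n) (k.*2.+1%:R : R)^-1 <= 1 + ln n.*2%:R / 2.
Proof.
case: n => // n _.
(* with the odd number 2 n + 1 inside ln, the inductive step is
   ln (a + 2) - ln a >= 2 / (a + 2) for a = 2 n + 1 *)
have key : \sum_(0 <= k < n.+1) (k.*2.+1%:R : R)^-1 <= 1 + ln n.*2.+1%:R / 2.
  elim: n => [|n IH]; first by rewrite big_nat1 ln1 mul0r addr0 invr1.
  rewrite big_nat_recr//=; set a : R := n.*2.+1%:R in IH *.
  have a0 : 0 < a by rewrite ltr0n.
  have -> : n.+1.*2.+1%:R = a + 2 :> R by rewrite doubleS -[n.*2.+3]addn2 natrD.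
  have a20 : 0 < a + 2 by rewrite addr_gt0.
  have : ln (1 + - (2 / (a + 2))) <= - (2 / (a + 2)).
    by apply: le_ln1Dx; rewrite ltrN2 ltr_pdivrMr// mul1r ltrDr.
  have -> : 1 + - (2 / (a + 2)) = a / (a + 2) by field; rewrite gt_eqF.
  rewrite ln_div ?posrE// => ln_step.
  have : (a + 2)^-1 * 2 = 2 / (a + 2) by rewrite mulrC.
  lra.
apply: (le_trans key); rewrite lerD2l ler_pM2r ?invr_gt0//.
by rewrite ler_ln ?posrE ?ltr0n// ler_nat doubleS.
Qed.

Lemma sum_inv_sqrt_odd_ge n :
  Num.sqrt n.*2.+1%:R - 1 <= \sum_(0 <= k < n) (Num.sqrt (k.*2.+1%:R : R))^-1.
Proof.
elim: n => [|n IH]; first by rewrite big_geq// sqrtr1 subrr.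
rewrite big_nat_recr//=.
rewrite -(lerD2r (Num.sqrt n.*2.+1%:R)^-1) in IH; apply: le_trans IH.
set a := Num.sqrt n.*2.+1%:R; set b := Num.sqrt n.+1.*2.+1%:R.
have a0 : 0 < a by rewrite sqrtr_gt0 ltr0n.
have ab : a <= b by rewrite ler_wsqrtr// ler_nat; lia.
have a2b : b ^+ 2 = a ^+ 2 + 2.
  by rewrite !sqr_sqrtr ?ler0n// -natrD; congr _%:R; lia.
have : b - a <= a^-1; last by lra.
rewrite -(ler_pM2r a0) mulVf ?gt_eqF//; nra.
Qed.

(** As 1 / (sqrt 2 + 1) = sqrt 2 - 1, squaring reduces this to
    x (x - 1) >= 0, with equality at x = 1. *)
Lemma sqrt_succ_ge x : 1 <= x ->
  x / (Num.sqrt 2 + 1) <= Num.sqrt (x ^+ 2 + 1) - 1.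
Proof.
move=> x1; set r := Num.sqrt 2.
have r2 : r ^+ 2 = 2 by rewrite sqr_sqrtr.
have r0 : 0 <= r by exact: sqrtr_ge0.
have r1 : 1 < r by rewrite -sqrtr1 ltr_sqrt// ltr1n.
have -> : x / (r + 1) = (r - 1) * x.
  apply: (mulIf (lt0r_neq0 (_ : 0 < r + 1))); first by lra.
  rewrite mulfVK; last by rewrite lt0r_neq0//; lra.
  by rewrite mulrAC -[LHS]mul1r; congr (_ * _); nra.
rewrite lerBrDr -(ler_pXn2r (n := 2))// ?nnegrE ?sqrtr_ge0//; last first.
  by rewrite addr_ge0// mulr_ge0; lra.
rewrite sqr_sqrtr; last by rewrite addr_ge0// sqr_ge0.
have : 0 <= (r - 1) * x * (x - 1) by rewrite !mulr_ge0//; lra.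
have -> : ((r - 1) * x + 1) ^+ 2 =
  x ^+ 2 + 1 - 2 * ((r - 1) * x * (x - 1)) + (r ^+ 2 - 2) * x ^+ 2 by ring.
by rewrite r2; lra.
Qed.

(** If x <= A^2 then ln x <= 2 |ln A|. Otherwise A <= sqrt x, and
    ln x = 2 ln (sqrt x) <= 2 sqrt x. *)
Lemma mul_ln_le A x : 0 < A -> 1 <= x -> A * `|ln A| <= x -> A * ln x <= 2 * x.
Proof.
move=> A0 x1 Ax; have x0 : 0 < x by exact: lt_le_trans x1.
have [xA|Ax2] := leP x (A ^+ 2).
  have : ln x <= 2 * `|ln A|.
    have : ln x <= ln (A ^+ 2) by rewrite ler_ln ?posrE ?exprn_gt0.
    rewrite lnXn// mulr2n => lnx.
    by have := ler_norm (ln A); lra.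
  by move=> /(ler_wpM2l (ltW A0)); nra.
have s0 : 0 < Num.sqrt x by rewrite sqrtr_gt0.
have sA : A <= Num.sqrt x.
  by rewrite -(ger0_norm (ltW A0)) -sqrtr_sqr ler_wsqrtr// ltW.
have lnx : ln x <= 2 * Num.sqrt x.
  rewrite -{1}(sqr_sqrtr (ltW x0)) lnXn// mulr2n.
  by have := ltW (ln_sublinear s0); lra.
have lnx0 : 0 <= ln x by rewrite ln_ge0.
have x2 : Num.sqrt x ^+ 2 = x by rewrite sqr_sqrtr// ltW.
nra.
Qed.

(** After inserting the bounds on the sums of the step sizes and of their
    squares, the right-hand side is eps x / C with x = sqrt T and C = W r. The
    error E uses up half of it. In the other half, one quarter pays for
    Delta + L / 4 and one quarter for the logarithm, through the two lower
    bounds on T; the latter is [mul_ln_le] with A = 2 C L / eps. *)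
Lemma step_size_tradeoff n L eps W Delta E : (0 < n)%N ->
  0 < L -> 0 < eps -> 0 < W -> 0 <= Delta ->
  let T : R := n.*2%:R in let r := Num.sqrt 2 + 1 in
  E / T <= eps / (2 * W * r * Num.sqrt T) ->
  W ^+ 2 * r ^+ 2 / eps ^+ 2 * (4 * Delta + L) ^+ 2 <= T ->
  4 * W ^+ 2 * r ^+ 2 * L ^+ 2 / eps ^+ 2 *
    ln (2 * r * W * L / eps) ^+ 2 <= T ->
  Delta + L / 4 * (\sum_(0 <= k < n) (k.*2.+1%:R : R)^-1) + E <=
  eps / W * \sum_(0 <= k < n) (Num.sqrt (k.*2.+1%:R : R))^-1.
Proof.
move=> n0 L0 eps0 W0 D0 T r ET T1 T2.
have r0 : 0 < r by rewrite ltr_wpDl// sqrtr_ge0.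
pose x := Num.sqrt T.
have T_ge1 : 1 <= T by rewrite ler1n double_gt0.
have T0 : 0 < T by exact: lt_le_trans T_ge1.
have x2 : x ^+ 2 = T by rewrite sqr_sqrtr// ltW.
have x1 : 1 <= x by rewrite -sqrtr1 ler_wsqrtr.
have x0 : 0 < x by exact: lt_le_trans x1.
pose C := W * r; have C0 : 0 < C by rewrite mulr_gt0.
have sum_lo : x / r <= \sum_(0 <= k < n) (Num.sqrt (k.*2.+1%:R : R))^-1.
  apply: le_trans (sum_inv_sqrt_odd_ge n).
  have := sqrt_succ_ge x1; rewrite x2 => /le_trans; apply.
  by rewrite /T natr1.
have sum_hi : \sum_(0 <= k < n) (k.*2.+1%:R : R)^-1 <= 1 + ln x.
  apply: le_trans (sum_inv_odd_le n0) _.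
  by rewrite -/T -x2 lnXn// -[ln x *+ 2]mulr_natr mulfK// pnatr_eq0.
have sq_le y : 0 <= y -> y ^+ 2 <= T -> y <= x.
  by move=> y0 yT; rewrite -(ger0_norm y0) -sqrtr_sqr ler_wsqrtr.
have first_le : C * (4 * Delta + L) <= eps * x.
  have : C / eps * (4 * Delta + L) <= x.
    apply: sq_le.
      by apply: mulr_ge0; [rewrite divr_ge0 ?ltW|lra].
    by rewrite !exprMn exprVn.
  by rewrite mulrAC ler_pdivrMr// [x * _]mulrC.
have second_le : C * L * ln x <= eps * x.
  pose A := 2 * C * L / eps.
  have A0 : 0 < A by rewrite divr_gt0 ?mulr_gt0.
  have : A * `|ln A| <= x.
    apply: sq_le; first by rewrite mulr_ge0// ltW.
    rewrite exprMn real_normK ?num_real//.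
    have -> : A = 2 * r * W * L / eps by rewrite /A /C; field; rewrite gt_eqF.
    apply: le_trans T2; rewrite le_eqVlt; apply/orP; left; apply/eqP.
    by congr (_ * _); field; rewrite gt_eqF.
  move=> /(mul_ln_le A0 x1).
  have -> : A * ln x = (C * L * ln x) * 2 / eps.
    by rewrite /A; field; rewrite gt_eqF.
  by rewrite ler_pdivrMr//; lra.
have E_le : E <= eps * x / (2 * C).
  move: ET; rewrite ler_pdivrMr// => /le_trans; apply.
  rewrite -/x -x2 le_eqVlt; apply/orP; left; apply/eqP; rewrite /C; field.
  by rewrite !gt_eqF.
apply: (@le_trans _ _ (eps / W * (x / r))); last first.
  by rewrite ler_wpM2l// divr_ge0 ?ltW.
have -> : eps / W * (x / r) = 2 * eps * x / (4 * C) + eps * x / (2 * C).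
  by rewrite /C; field; rewrite !gt_eqF.
apply: lerD => //.
rewrite ler_pdivlMr ?mulr_gt0//.
have : L / 4 * \sum_(0 <= k < n) (k.*2.+1%:R : R)^-1 <= L / 4 * (1 + ln x).
  by rewrite ler_wpM2l// divr_ge0 ?ltW.
nra.
Qed.

End scalar.

(** * Direct search *)

Lemma le_sup_gaps (R : realType) p (f g : 'rV[R]_p -> R) x :
  has_ubound (gaps f g) -> `|f x - g x| <= sup (gaps f g).
Proof. by move=> fg; apply: ub_le_sup => //; exists x. Qed.

Lemma sup_gaps_ge0 (R : realType) p (f g : 'rV[R]_p -> R) :
  has_ubound (gaps f g) -> 0 <= sup (gaps f g).
Proof. by move=> fg; apply: le_trans (le_sup_gaps 0 fg). Qed.

Section direct_search.
Context (R : realType) (q : nat).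
Local Notation p := q.+1.
Context (Phi : nat -> 'rV[R]_p -> R) (L Phi_low : R) (L_gt0 : 0 < L)
  (Phi_smooth : forall t, lipschitz_grad L (Phi t))
  (Phi_ge : forall t u, Phi_low <= Phi t u)
  (Phit : nat -> 'rV[R]_p -> R)
  (Phit_cont : forall t, continuous (Phit t))
  (drift_fin : forall t, has_ubound (gaps (Phi t.+1) (Phi t)))
  (error_fin : forall t, has_ubound (gaps (Phit t) (Phi t)))
  (delta : nat -> R) (delta_gt0 : forall t, 0 < delta t).

Definition search_error t :=
  2 * (drift Phi t + drift Phi t.+1) +
  2 * (oracle_error Phit Phi t + oracle_error Phit Phi t.+1).

Lemma search_error_ge0 t : 0 <= search_error t.
Proof.
have d0 i : 0 <= drift Phi i by exact: sup_gaps_ge0.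
have b0 i : 0 <= oracle_error Phit Phi i by exact: sup_gaps_ge0.
have := (d0 t, d0 t.+1, b0 t, b0 t.+1) => -[[[? ?] ?] ?].
by rewrite /search_error; lra.
Qed.

Definition search_update t (x h : 'rV[R]_p) : 'rV[R]_p :=
  if Phit t.+1 (x + delta t *: h) <= Phit t x then x + delta t *: h else x.

(** The test compares oracle values. Replacing them by values of Phi_t costs
    oracle errors and one drift, and one or two further drifts lead from the
    retained value to Phi_(t+2). *)
Lemma search_update_le t x h :
  Phi t.+2 (search_update t x h) <=
  Num.min (Phi t x) (Phi t (x + delta t *: h)) + search_error t.
Proof.
rewrite /search_update /search_error; set y := x + delta t *: h.
have d i z : `|Phi i.+1 z - Phi i z| <= drift Phi i by exact: le_sup_gaps.
have b i z : `|Phit i z - Phi i z| <= oracle_error Phit Phi i.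
  exact: le_sup_gaps.
have d0 i : 0 <= drift Phi i by exact: sup_gaps_ge0.
have b0 i : 0 <= oracle_error Phit Phi i by exact: sup_gaps_ge0.
have := (d0 t, d0 t.+1, b0 t, b0 t.+1) => -[[[? ?] ?] ?].
have /[!ler_norml] /andP[? ?] := d t x.
have /[!ler_norml] /andP[? ?] := d t y.
have /[!ler_norml] /andP[? ?] := d t.+1 x.
have /[!ler_norml] /andP[? ?] := d t.+1 y.
have /[!ler_norml] /andP[? ?] := b t x.
have /[!ler_norml] /andP[? ?] := b t.+1 y.
rewrite addr_minl le_min.
by case: (leP (Phit t.+1 y) (Phit t x)) => ?; apply/andP; split; lra.
Qed.

(** The minimum in [search_update_le] is bounded by its first term when
    <g, h> >= 0 and by its second term otherwise, so the curvature term is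
    charged in the latter case only. *)
Lemma search_descent t x h :
  (Phi t.+2 (search_update t x h) - Phi_low) +
    delta t * Num.max 0 (- dot (grad (Phi t) x) h) <=
  (Phi t x - Phi_low) +
    L * delta t ^+ 2 / 2 *
      (if dot (grad (Phi t) x) h < 0 then enorm h ^+ 2 else 0) +
    search_error t.
Proof.
have := search_update_le t x h; rewrite addr_minl le_min => /andP[stay move_].
have := descent (Phi_smooth t) x (delta t *: h).
rewrite dotZr enormZ gtr0_norm// exprMn => step_le.
case: ltP => g0; last first.
  by rewrite max_l ?oppr_le0// !mulr0; lra.
by rewrite max_r; [lra|rewrite oppr_ge0 ltW].
Qed.

Lemma measurable_search_update t :
  measurable_fun setT
    (fun z : borel_rV R p * borel_rV R p =>
      search_update t z.1 z.2 : borel_rV R p).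
Proof.
have mstep : measurable_fun setT (fun z : borel_rV R p * borel_rV R p =>
    (z.1 : 'rV[R]_p) + delta t *: (z.2 : 'rV[R]_p) : borel_rV R p).
  apply: measurable_fun_rV => i.
  rewrite (_ : (fun z => _) = (fun z : borel_rV R p * borel_rV R p =>
      (z.1 : 'rV[R]_p) ord0 i + delta t * (z.2 : 'rV[R]_p) ord0 i)).
    apply: measurable_funD; last apply: measurable_funM => //.
      exact: (measurableT_comp (@measurable_coord_rV R p i) measurable_fst).
    exact: (measurableT_comp (@measurable_coord_rV R p i) measurable_snd).
  by apply/funext => z; rewrite !mxE.
have mPhit s := continuous_measurable_rV (@Phit_cont s).
apply: measurable_fun_ifT => //.
apply: measurable_fun_ler; first exact: (measurableT_comp (mPhit t.+1) mstep).
exact: (measurableT_comp (mPhit t) measurable_fst).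
Qed.

End direct_search.

Section expected_descent.
Context (R : realType) (q : nat).
Local Notation p := q.+1.
Context (Phi : nat -> 'rV[R]_p -> R) (L Phi_low : R) (L_gt0 : 0 < L)
  (Phi_smooth : forall t, lipschitz_grad L (Phi t))
  (Phi_ge : forall t u, Phi_low <= Phi t u)
  (Phit : nat -> 'rV[R]_p -> R)
  (Phit_cont : forall t, continuous (Phit t))
  (drift_fin : forall t, has_ubound (gaps (Phi t.+1) (Phi t)))
  (error_fin : forall t, has_ubound (gaps (Phit t) (Phi t)))
  (delta : nat -> R) (delta_gt0 : forall t, 0 < delta t)
  (d : measure_display) (Omega : measurableType d) (P : probability Omega R).
Local Notation W := (Num.sqrt (2 * pi * p%:R) : R).

Lemma sqrt_2pip_gt0 : 0 < W.
Proof. by rewrite sqrtr_gt0 !mulr_gt0// pi_gt0. Qed.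

Lemma measurable_dot_grad t : measurable_fun setT
  (fun z : borel_rV R p * borel_rV R p => dot (grad (Phi t) z.1) z.2).
Proof.
apply: measurable_sum => i; apply: measurable_funM.
  apply: (measurableT_comp
    (f := fun x : borel_rV R p => grad (Phi t) x ord0 i)) => //.
  apply: continuous_measurable_rV.
  exact: (continuous_grad L_gt0 (Phi_smooth t)).
exact: (measurableT_comp (@measurable_coord_rV R p i) measurable_snd).
Qed.

Lemma measurable_enorm_grad t :
  measurable_fun setT (fun x : borel_rV R p => enorm (grad (Phi t) x)).
Proof.
apply: (measurableT_comp (@measurable_enorm R p)
  (f := fun x : borel_rV R p => enorm (x : 'rV[R]_p))).
apply: measurable_fun_rV => i; apply: continuous_measurable_rV.
exact: (continuous_grad L_gt0 (Phi_smooth t)).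
Qed.

Section one_step.
Context (U : Omega -> borel_rV R p) (V : {RV P >-> borel_rV R p}) (t : nat)
  (mU : measurable_fun setT U) (UV : indep_fun P U V)
  (V_normal : isotropic_normal (p%:R^-1) V).

Let pinv_gt0 : 0 < (p%:R^-1 : R). Proof. by rewrite invr_gt0 ltr0n. Qed.

Lemma directional_decrease_expectation :
  (\int[P]_w (Num.max 0 (- dot (grad (Phi t) (U w)) (V w)))%:E =
   W^-1%:E * \int[P]_w (enorm (grad (Phi t) (U w)))%:E)%E.
Proof.
pose f (z : borel_rV R p * borel_rV R p) :=
  (Num.max 0 (- dot (grad (Phi t) z.1) z.2))%:E.
have mf : measurable_fun setT f.
  apply/measurable_EFinP; apply: measurable_maxr => //.
  by apply: measurable_funN; exact: measurable_dot_grad.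
have f0 z : (0 <= f z)%E by rewrite lee_fin le_max lexx.
rewrite [LHS](indep_ge0_integral mU (measurable_funPT V) UV mf f0).
rewrite -ge0_integralZl//; last 2 first.
- apply/measurable_EFinP.
  exact: (measurableT_comp (measurable_enorm_grad t) mU).
- by move=> w _; rewrite lee_fin enorm_ge0.
apply: eq_integral => w _.
rewrite /f/= (dot_neg_part_expectation pinv_gt0 V_normal) -EFinM; congr (_%:E).
rewrite mulrC; congr (_ * _).
by rewrite sqrtrV ?ler0n// -invfM -sqrtrM ?ler0n// mulrC.
Qed.

Lemma curvature_cost_expectation :
  (\int[P]_w (if (dot (grad (Phi t) (U w)) (V w) < 0)%R
               then (enorm (V w) ^+ 2)%R else 0%R)%:E <= (2^-1)%:E)%E.
Proof.
pose f (z : borel_rV R p * borel_rV R p) : \bar R :=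
  (if (dot (grad (Phi t) z.1) z.2 < 0)%R then (enorm z.2 ^+ 2)%R else 0%R)%:E.
have mf : measurable_fun setT f.
  apply/measurable_EFinP; apply: measurable_fun_ifT => //.
    by apply: measurable_fun_ltr => //; exact: measurable_dot_grad.
  apply: measurable_funX.
  exact: (measurableT_comp (@measurable_enorm R p) measurable_snd).
have f0 z : (0 <= f z)%E by rewrite lee_fin; case: ifP; rewrite ?sqr_ge0.
rewrite [leLHS](indep_ge0_integral mU (measurable_funPT V) UV mf f0).
apply: (@le_trans _ _ (\int[P]_w (2^-1)%:E)%E).
  apply: ge0_le_integral => //.
  - by move=> w _; apply: integral_ge0.
  - have := measurable_fun_fubini_tonelli_F (m2 := distribution P V) f mf f0.
    move=> /measurableT_comp /(_ mU); apply: eq_measurable_fun => w _ /=.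
    rewrite /fubini_F [LHS](ge0_integral_distribution V)//.
    exact: measurable_fun_pair2.
  - move=> w _.
    have := enorm_sqr_halfspace_expectation pinv_gt0 V_normal
      (grad (Phi t) (U w)).
    by rewrite divff ?mul1r// pnatr_eq0.
by rewrite integral_cst// [X in (_ * X)%E](probability_setT P) mule1.
Qed.

(** [search_descent] integrated; the expected norm of the gradient appears
    through [directional_decrease_expectation]. *)
Lemma expected_descent :
  (\int[P]_w (Phi t.+2 (search_update Phit delta t (U w) (V w)) - Phi_low)%:E +
     (delta t / W)%:E * \int[P]_w (enorm (grad (Phi t) (U w)))%:E <=
   \int[P]_w (Phi t (U w) - Phi_low)%:E +
     (L * delta t ^+ 2 / 4 + search_error Phi Phit t)%:E)%E.
Proof.
have mUV := measurable_fun_pair mU (measurable_funPT V).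
have mPhi s := continuous_measurable_rV (continuous_smooth (Phi_smooth s)).
have mnew : measurable_fun setT (fun w =>
    (Phi t.+2 (search_update Phit delta t (U w) (V w)) - Phi_low)%:E).
  apply/measurable_EFinP; apply: measurable_funB => //.
  have := measurableT_comp (mPhi t.+2)
    (measurableT_comp (measurable_search_update Phit_cont delta t) mUV).
  exact.
have mdot : measurable_fun setT (fun w => dot (grad (Phi t) (U w)) (V w)).
  exact: (measurableT_comp (measurable_dot_grad t) mUV).
have mdec : measurable_fun setT (fun w =>
    (Num.max 0 (- dot (grad (Phi t) (U w)) (V w)))%:E).
  apply/measurable_EFinP; apply: measurable_maxr => //.
  exact: measurable_funN.
pose cost w : R :=
  if dot (grad (Phi t) (U w)) (V w) < 0 then enorm (V w) ^+ 2 else 0.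
have mcost : measurable_fun setT (fun w => (cost w)%:E).
  apply/measurable_EFinP; apply: measurable_fun_ifT => //.
    exact: measurable_fun_ltr.
  apply: measurable_funX.
  exact: (measurableT_comp (@measurable_enorm R p) (measurable_funPT V)).
have mold : measurable_fun setT (fun w => (Phi t (U w) - Phi_low)%:E).
  apply/measurable_EFinP; apply: measurable_funB => //.
  exact: (measurableT_comp (mPhi t) mU).
have err0 := search_error_ge0 drift_fin error_fin t.
have d0 := delta_gt0 t.
have c0 : 0 <= L * delta t ^+ 2 / 2.
  by rewrite divr_ge0// mulr_ge0 ?sqr_ge0// ltW.
have dec0 w : (0 <= (Num.max 0 (- dot (grad (Phi t) (U w)) (V w)))%:E)%E.
  by rewrite lee_fin le_max lexx.
have cost0 w : (0 <= (cost w)%:E)%E.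
  by rewrite lee_fin /cost; case: ifP; rewrite ?sqr_ge0.
have Phi0 s x : (0 <= (Phi s x - Phi_low)%:E)%E by rewrite lee_fin subr_ge0.
have -> : ((delta t / W)%:E * \int[P]_w (enorm (grad (Phi t) (U w)))%:E =
    \int[P]_w ((delta t)%:E *
      (Num.max 0 (- dot (grad (Phi t) (U w)) (V w)))%:E))%E.
  rewrite ge0_integralZl//; last by rewrite lee_fin ltW.
  by rewrite directional_decrease_expectation muleA -EFinM.
rewrite -ge0_integralD//; last 2 first.
- by move=> w _; rewrite mule_ge0// lee_fin ltW.
- exact: emeasurable_funM.
apply: (@le_trans _ _ (\int[P]_w ((Phi t (U w) - Phi_low)%:E +
    ((L * delta t ^+ 2 / 2)%:E * (cost w)%:E +
     (search_error Phi Phit t)%:E)))%E).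
  apply: ge0_le_integral => //.
  - by move=> w _; rewrite adde_ge0// mule_ge0// lee_fin ltW.
  - by apply: emeasurable_funD => //; exact: emeasurable_funM.
  - apply: emeasurable_funD => //; apply: emeasurable_funD => //.
    exact: emeasurable_funM.
  - move=> w _; rewrite -!EFinM -!EFinD lee_fin addrA.
    exact: (search_descent Phi_low Phi_smooth drift_fin error_fin delta_gt0).
rewrite ge0_integralD//; last 2 first.
- by move=> w _; rewrite adde_ge0// mule_ge0.
- by apply: emeasurable_funD => //; exact: emeasurable_funM.
rewrite leeD2l// ge0_integralD//; last 2 first.
- by move=> w _; rewrite mule_ge0.
- exact: emeasurable_funM.
have -> : (\int[P]_w (search_error Phi Phit t)%:E =
    (search_error Phi Phit t)%:E)%E.
  by rewrite integral_cst// [X in (_ * X)%E](probability_setT P) mule1.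
rewrite ge0_integralZl// (EFinD (L * delta t ^+ 2 / 4)); apply: leeD2r.
have -> : L * delta t ^+ 2 / 4 = L * delta t ^+ 2 / 2 * 2^-1 by field.
rewrite [leRHS]EFinM; apply: lee_wpmul2l; first by rewrite lee_fin.
exact: curvature_cost_expectation.
Qed.

End one_step.
End expected_descent.

(** * The main bound *)

Lemma weighted_mean_le (R : realType) n (c : nat -> R) (G : nat -> \bar R)
    (eps : R) :
  (0 < n)%N -> (forall k, 0 < c k) ->
  (\sum_(0 <= k < n) (c k)%:E * G k <= (eps * \sum_(0 <= k < n) c k)%:E)%E ->
  exists2 k, (k < n)%N & (G k <= eps%:E)%E.
Proof.
move=> n0 c0; apply: contraPP => /forall2NP Geps; apply/negP; rewrite -ltNge.
have {}Geps k : (k < n)%N -> (eps%:E < G k)%E.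
  by move=> kn; have [//|/negP] := Geps k; rewrite -ltNge.
have term k : (k < n)%N -> ((eps * c k)%:E < (c k)%:E * G k)%E.
  by move=> kn; rewrite mulrC EFinM lte_pmul2l ?lte_fin// Geps.
case: n n0 {Geps} term => // n _; elim: n => [|n IH] term.
  by rewrite !big_nat1 term.
rewrite big_nat_recr//= [in ltRHS]big_nat_recr//= mulrDr EFinD lteD ?term//.
by apply: IH => k kn; rewrite term// ltnS ltnW.
Qed.

(** The product rule of [mutually_independent] on the even times, reindexed by
    an initial segment as [indep_markov_chain] expects. *)
Lemma mutually_independent_double d d' (Omega : measurableType d)
    (T : measurableType d') (R : realType) (P : probability Omega R)
    (v : nat -> {RV P >-> T}) :
  mutually_independent [set t | ~~ odd t] v ->
  forall n (A : nat -> set T), (forall i, measurable (A i)) ->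
    P [set w | forall i, (i < n)%N -> A i (v i.*2 w)] =
    (\prod_(0 <= i < n) P (v i.*2 @^-1` A i))%E.
Proof.
move=> indep n A mA.
pose s := [seq i.*2 | i <- index_iota 0 n].
pose J : {fset nat} := [fset t in s]%fset.
have Js : perm_eq J s.
  apply: uniq_perm; [exact: fset_uniq| |by move=> t; rewrite inE].
  by rewrite map_inj_uniq ?iota_uniq//; exact: double_inj.
have := indep J (fun t => A t./2) _ (fun t => mA t./2).
rewrite (perm_big s)//= big_map.
under [X in _ = X]eq_bigr do rewrite doubleK.
move=> <-.
  congr (P _); apply/seteqP; split => w /= Aw.
    move=> t; rewrite /= !inE => /mapP[i].
    rewrite mem_index_iota => /andP[_ ni] ->.
    by rewrite /= doubleK; exact: Aw.
  move=> i ni; have := Aw i.*2; rewrite /= doubleK; apply.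
  by rewrite /= !inE; apply/mapP; exists i; rewrite ?mem_index_iota.
move=> t; rewrite /= !inE => /mapP[i _ ->].
by rewrite odd_double.
Qed.

Lemma sum_double (R : realType) (F : nat -> R) n :
  \sum_(0 <= t < n.*2) F t = \sum_(0 <= k < n) (F k.*2 + F k.*2.+1).
Proof.
elim: n => [|n IH]; first by rewrite !big_geq.
by rewrite doubleS !big_nat_recr//= IH addrA.
Qed.

Theorem theorem3p4 (R : realType) (p : nat) (p_ge1 : (1 <= p)%N)
  (Phi : nat -> 'rV[R]_p -> R) (L Phi_low : R) (L_gt0 : 0 < L)
  (Phi_smooth : forall t, lipschitz_grad L (Phi t))
  (Phi_ge : forall t u, Phi_low <= Phi t u)
  (Phit : nat -> 'rV[R]_p -> R)
  (Phit_cont : forall t, continuous (Phit t))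
  (drift_fin : forall t, has_ubound (gaps (Phi t.+1) (Phi t)))
  (error_fin : forall t, has_ubound (gaps (Phit t) (Phi t)))
  (d : measure_display) (Omega : measurableType d) (P : probability Omega R)
  (v : nat -> {RV P >-> borel_rV R p})
  (v_normal : forall t, ~~ odd t -> isotropic_normal (p%:R^-1) (v t))
  (v_indep : mutually_independent [set t | ~~ odd t] v)
  (u0 : 'rV[R]_p) (u : nat -> Omega -> 'rV[R]_p)
  (u_search : forall w : Omega,
    online_direct_search Phit (fun t => (Num.sqrt t.+1%:R)^-1) u0
      (fun t => v t w) (fun t => u t w))
  (eps : R) (eps_gt0 : 0 < eps)
  (T : nat) (T_ge2 : (2 <= T)%N) (T_even : ~~ odd T)
  (ET_le :
    let DT := \sum_(0 <= t < T) drift Phi t in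
    let BT := \sum_(0 <= t < T) oracle_error Phit Phi t in
    (2 * DT + 2 * BT) / T%:R <=
      eps / (2 * Num.sqrt (2 * pi * p%:R) * (Num.sqrt 2 + 1) * Num.sqrt T%:R))
  (T_large :
    Num.max
      (2 * pi * p%:R * (Num.sqrt 2 + 1) ^+ 2 / eps ^+ 2 *
         (4 * (Phi 0%N u0 - Phi_low) + L) ^+ 2)
      (8 * pi * p%:R * (Num.sqrt 2 + 1) ^+ 2 * L ^+ 2 / eps ^+ 2 *
         ln (2 * (Num.sqrt 2 + 1) * Num.sqrt (2 * pi * p%:R) * L / eps) ^+ 2)
    <= T%:R) :
  (\big[mine/+oo]_(0 <= t < T | ~~ odd t)
     'E_P[fun w => enorm (grad (Phi t) (u t w))] <= eps%:E)%E.
Proof.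
destruct p as [|q]; first by [].
set delta := fun t : nat => (Num.sqrt t.+1%:R)^-1 : R.
have delta_gt0 t : 0 < delta t by rewrite invr_gt0 sqrtr_gt0 ltr0n.
set W := Num.sqrt (2 * pi * q.+1%:R) in ET_le T_large *.
have W0 : 0 < W by exact: sqrt_2pip_gt0.
have W2 : W ^+ 2 = 2 * pi * q.+1%:R.
  by rewrite sqr_sqrtr// !mulr_ge0 ?pi_ge0.
have uS k w : u k.+1.*2 w = search_update Phit delta k.*2 (u k.*2 w) (v k.*2 w).
  have [_ /(_ k.*2)] := u_search w; rewrite odd_double => -[]// uS1 uS2.
  by rewrite doubleS uS2 uS1.
have u00 : u 0%N = cst u0 by apply/funext => w; have [] := u_search w.
(* the iterates at even times form a chain driven by the directions *)
pose h k (z : borel_rV R q.+1 * borel_rV R q.+1) : borel_rV R q.+1 :=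
  search_update Phit delta k.*2 z.1 z.2.
have chain k : measurable_fun setT (u k.*2 : Omega -> borel_rV R q.+1) /\
    indep_fun P (u k.*2 : Omega -> borel_rV R q.+1) (v k.*2).
  have [|||||mu ind] := @indep_markov_chain _ _ _ Omega (borel_rV R q.+1)
      (borel_rV R q.+1) R P k.+1 (fun i => v i.*2) h u0 (fun i => u i.*2)
      _ _ _ _ _ k.
  - by move=> i; exact: measurable_funPT.
  - by move=> i; exact: measurable_search_update.
  - by move=> n A _; exact: (mutually_independent_double v_indep).
  - by [].
  - by move=> i w; rewrite uS.
  - by split => //; exact: ind.
pose n := T./2.
have Tn : T = n.*2 by rewrite -[LHS]odd_double_half (negbTE T_even).
have n0 : (0 < n)%N by rewrite half_gt0.
pose G k := (\int[P]_w (enorm (grad (Phi k.*2) (u k.*2 w)))%:E)%E.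
pose Y k := (\int[P]_w (Phi k.*2 (u k.*2 w) - Phi_low)%:E)%E.
pose c k := L * delta k.*2 ^+ 2 / 4 + search_error Phi Phit k.*2.
have step k : (Y k.+1 + (delta k.*2 / W)%:E * G k <= Y k + (c k)%:E)%E.
  have [mu ind] := chain k.
  have vk : isotropic_normal (q.+1%:R^-1) (v k.*2).
    by apply: v_normal; rewrite odd_double.
  have -> : Y k.+1 = (\int[P]_w (Phi k.*2.+2
      (search_update Phit delta k.*2 (u k.*2 w) (v k.*2 w)) - Phi_low)%:E)%E.
    by apply: eq_integral => w _; rewrite uS.
  exact: (expected_descent L_gt0 Phi_smooth Phi_ge Phit_cont drift_fin error_fin
    delta_gt0 k.*2 mu ind vk).
(* the bounds of the even steps up to time 2 m, added up *)
have tele m : (Y m + \sum_(0 <= k < m) (delta k.*2 / W)%:E * G k <=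
    (Phi 0%N u0 - Phi_low + \sum_(0 <= k < m) c k)%:E)%E.
  elim: m => [|m IH].
    rewrite !big_geq// adde0 addr0.
    have -> : Y 0%N = (\int[P]_w (cst (Phi 0%N u0 - Phi_low)%:E w))%E.
      by apply: eq_integral => w _; rewrite u00.
    by rewrite integral_cst// [X in (_ * X)%E](probability_setT P) mule1.
  rewrite !big_nat_recr//= addeCA [X in (_ <= X%:E)%E]addrA EFinD.
  apply: le_trans (leeD2l _ (step m)) _.
  by rewrite addeA; apply: leeD2r; rewrite addeC.
have Y0 m : (0 <= Y m)%E.
  by apply: integral_ge0 => w _; rewrite lee_fin subr_ge0.
(* Y n >= 0 is dropped: the weighted sum of the G k is then at most eps times
   the sum of the weights *)
have [] := @weighted_mean_le R n (fun k => delta k.*2 / W) G eps n0.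
- by move=> k; rewrite divr_gt0.
- apply: le_trans (leeDr _ (Y0 n)) _; apply: le_trans (tele n) _.
  rewrite lee_fin.
  have cE : \sum_(0 <= k < n) c k =
      L / 4 * (\sum_(0 <= k < n) (k.*2.+1%:R : R)^-1) +
      (2 * (\sum_(0 <= t < T) drift Phi t) +
       2 * (\sum_(0 <= t < T) oracle_error Phit Phi t)).
    rewrite Tn !sum_double !mulr_sumr -!big_split/=; apply: eq_bigr => k _.
    rewrite /c /search_error /delta exprVn sqr_sqrtr ?ler0n//.
    by rewrite mulrAC.
  have cond := T_large; rewrite ge_max in cond; case/andP: cond => T1 T2.
  have -> : eps * \sum_(0 <= k < n) delta k.*2 / W =
      eps / W * \sum_(0 <= k < n) (Num.sqrt (k.*2.+1%:R : R))^-1.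
    by rewrite -mulr_suml mulrA mulrAC.
  rewrite cE addrA.
  apply: step_size_tradeoff => //; rewrite -?Tn.
  + by rewrite subr_ge0.
  + exact: ET_le.
  + by rewrite W2.
  + rewrite W2; apply: le_trans T2.
    by rewrite le_eqVlt; apply/orP; left; apply/eqP; congr (_ * _); ring.
- move=> k kn Gk; apply: (@bigmin_inf_seq _ _ _ _ _ k.*2).
  + by rewrite mem_index_iota/= Tn ltn_double.
  + by rewrite odd_double.
  + by rewrite unlock.
Qed.
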